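(* Let $J>0$ and $L>0$ be constants, let $0<\tau\le+\infty$ and $\alpha=1/\tau$ (with $\alpha=0$ if $\tau=+\infty$). For $i=1,2$ let $b_i$ be a constant with $0<b_i<J$, and let $(n_i,E_i)$ be a $C^1$-smooth transonic solution (in the sense given in the context) on $[0,L]$ of the boundary value problem $$\Big(n+\frac{J^2}{n}\Big)_x=nE-\alpha J,\qquad E_x=n-b_i,\quad 0<x<L,\qquad n(0)=n_{il},\quad n(L)=n_{ir},$$ where $0<n_{il}<J<n_{ir}$, and let $x_i>0$ be the point at which $n_i$ crosses the sonic line $n=J$. Then $(n_1,E_1)$ and $(n_2,E_2)$ are structurally stable in $C^1[0,L]\times C^2[0,L]$; namely, with a constant $C>0$, $$\|n_1-n_2\|_{C^1[0,L]}+\|E_1-E_2\|_{C^2[0,L]}\le C\,\delta_0,\qquad \delta_0:=|b_1-b_2|+|n_{1l}-n_{2l}|+|n_{1r}-n_{2r}|.$$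
   Context: The system is the stationary one-dimensional isothermal Euler–Poisson system (pressure $P(n)=n$, sound speed $1$) with constant current density $J=nu>0$, density $n>0$, electric field $E$, doping profile $b$ and momentum relaxation time $\tau$; $\alpha=1/\tau$. A state is supersonic if $0<n<J$, sonic if $n=J$, subsonic if $n>J$. Where $n\ne J$ the first equation is equivalent to $n_x=\dfrac{(nE-\alpha J)n^2}{n^2-J^2}$. A pair $(n,E)$ with $n>0$ is a $C^1$-smooth transonic solution on $I=[0,L]$ if it solves the problem, $(n,E)\in C^1(I)\times C^2(I)$, and there is a point $x_0\in(0,L)$ such that $0<n<J$ on $(0,x_0)$, $n(x_0)=J$, and $n>J$ for $x>x_0$ (so the supersonic part on $[0,x_0]$ and the subsonic part on $[x_0,L]$ match at $x_0$ together with $n'$, $E'$ and $E''$). For such solutions $E(x_0)=\alpha$. *)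

(* Defs.v *)
From Stdlib Require Import Reals.
From Coquelicot Require Import Coquelicot.
Open Scope R_scope.

(** [f] has derivative [l] at [x] relative to [[a, b]]: one-sided at the
    endpoints, two-sided inside. *)
Definition is_derive_on (a b : R) (f : R -> R) (x l : R) : Prop :=
  filterlim (fun y => (f y - f x) / (y - x))
    (within (fun y => a <= y <= b) (locally' x)) (locally l).

Definition ex_derive_on (a b : R) (f : R -> R) (x : R) : Prop :=
  exists l, is_derive_on a b f x l.

Definition Derive_on (a b : R) (f : R -> R) (x : R) : R :=
  iota (is_derive_on a b f x).

(** [C^k[a, b]]; only the values of [f] on [[a, b]] matter. *)
Fixpoint Ck_on (k : nat) (a b : R) (f : R -> R) : Prop :=
  match k with
  | O => continuous_on (fun x => a <= x <= b) f
  | S k' => (forall x, a <= x <= b -> ex_derive_on a b f x) /\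
            Ck_on k' a b (Derive_on a b f)
  end.

Definition sup_norm (a b : R) (f : R -> R) : Rbar :=
  Lub_Rbar (fun r => exists x, a <= x <= b /\ r = Rabs (f x)).

(** [sum_(j <= k) sup_[a, b] |f^(j)|], valued in [Rbar] so that an unbounded
    function has norm [p_infty] rather than a default value. *)
Fixpoint Ck_norm (k : nat) (a b : R) (f : R -> R) : Rbar :=
  match k with
  | O => sup_norm a b f
  | S k' => Rbar_plus (sup_norm a b f) (Ck_norm k' a b (Derive_on a b f))
  end.

(** [alpha = 1 / tau]; [Rbar_inv p_infty] is [0]. *)
Definition relaxation_rate (tau : Rbar) : R := real (Rbar_inv tau).

Definition euler_poisson (J alpha L b : R) (n E : R -> R) : Prop :=
  forall x, 0 < x < L ->
    is_derive (fun y => n y + J ^ 2 / n y) x (n x * E x - alpha * J) /\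
    is_derive E x (n x - b).

(** The sonic crossing point is the parameter [x0]. *)
Record C1_smooth_transonic_solution
    (J alpha L b nl nr : R) (n E : R -> R) (x0 : R) : Prop := {
  transonic_C1_n : Ck_on 1 0 L n;
  transonic_C2_E : Ck_on 2 0 L E;
  transonic_pos : forall x, 0 <= x <= L -> 0 < n x;
  transonic_eqn : euler_poisson J alpha L b n E;
  transonic_left : n 0 = nl;
  transonic_right : n L = nr;
  transonic_x0 : 0 < x0 < L;
  transonic_supersonic : forall x, 0 < x < x0 -> 0 < n x < J;
  transonic_sonic : n x0 = J;
  transonic_subsonic : forall x, x0 < x <= L -> J < n x
}.

(* Main.v *)
Require Import Defs.
From Stdlib Require Import Reals Lra Psatz.
From Coquelicot Require Import Coquelicot.
Open Scope R_scope.

(** Translate each solution so that its sonic point is [0], and write [P = n'].  Along a solution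
    the reciprocal [Z = 1 / P] satisfies the singular equation [mu(n) Z' = R(b, n, Z)], where
    [mu(n) = n (n^2 - J^2)] has the sign of [x] and [R] is strictly decreasing in [Z > 0].  Hence
    the equation is damped away from the sonic point in both directions, and a maximum principle
    that starts from the algebraic relation [R = 0] at [0] bounds [Z], [Z'], and the difference of
    [Z] for two solutions by [|b1 - b2|] on a window of uniform width.  Beyond the window
    [|n^2 - J^2|] is bounded below, so Gronwall's inequality for [(n, E)] continues the estimate.
    On the supersonic side this uses an energy that decreases in [x]: a critical point of [n] lies
    below [n = b], so [n] can approach [J] only along the increasing branch that ends at [0].
    Finally [n'] is bounded below on the subsonic side, so the value [n(L)] controls the position
    of the sonic point up to [|b1 - b2|], and Lipschitz bounds on [n], [E] and [P] undo the
    translation.  The datum [n(0)] only serves to exclude a return to the sonic state. *)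

(** * Differential inequalities and bounds *)

(** At the sonic point the formula for [n'] reads [0 / 0], so the standard theory of continuous
    dependence does not apply there, and since [n] is only C^1, [P] is not known to be
    differentiable at that point. Differentiating the equation once and eliminating [E] gives a
    closed system for [n] and [P]. The reciprocal is taken because of monotonicity: in terms of [P]
    the right-hand side is the quadratic [alpha J n^2 P + n^4 (n - b) - (3 J^2 - n^2) P^2], which
    for [alpha > 0] first increases in [P > 0], whereas [rate] strictly decreases in every [Z > 0]
    as long as [n > b].

    Damping in both directions leaves no free constant: the value at [0] is the positive root of
    [rate = 0], and two translated solutions can differ only through [b].

    The final constant must be uniform, so every constant is produced before the solutions and
    depends only on [J], [L], [alpha], on a bound [k < J] for [b] and the left datum, and on a bound
    [r] for the right datum. *)

Lemma continuous_max_on (f : R -> R) (a b : R) :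
  a <= b -> (forall x, a <= x <= b -> continuous f x) ->
  exists t, a <= t <= b /\ forall x, a <= x <= b -> f x <= f t.
Proof.
  intros Hab Hf.
  destruct (continuity_ab_maj f a b Hab) as [t [Ht1 Ht2]].
  - intros x Hx. apply continuity_pt_filterlim. now apply Hf.
  - exists t. split; assumption.
Qed.

Lemma derive_nonneg_at_left_max (f : R -> R) (a t d : R) :
  is_derive f t d -> a < t -> (forall x, a <= x <= t -> f x <= f t) -> 0 <= d.
Proof.
  intros Hd Hat Hm.
  apply Rnot_lt_le. intros Hneg.
  apply is_derive_Reals in Hd.
  destruct (Hd (- d)) as [del Hdel]; [lra|].
  set (h := Rmin (t - a) (del / 2)).
  assert (Hdp := cond_pos del).
  assert (Hh : 0 < h) by (unfold h; apply Rmin_glb_lt; lra).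
  assert (h <= t - a) by apply Rmin_l.
  assert (h <= del / 2) by apply Rmin_r.
  specialize (Hdel (- h)).
  assert (Hq : Rabs ((f (t + - h) - f t) / - h - d) < - d).
  { apply Hdel; [lra|]. rewrite Rabs_Ropp, Rabs_pos_eq; lra. }
  apply Rabs_def2 in Hq.
  assert (Hx := Hm (t + - h)).
  assert (f (t + - h) <= f t) by (apply Hx; lra).
  assert (0 <= (f (t + - h) - f t) / - h).
  { replace ((f (t + - h) - f t) / - h) with ((f t - f (t + - h)) / h) by (field; lra).
    apply Rmult_le_pos; [lra|]. left; now apply Rinv_0_lt_compat. }
  lra.
Qed.

Lemma derive_nonpos_at_right_max (f : R -> R) (b t d : R) :
  is_derive f t d -> t < b -> (forall x, t <= x <= b -> f x <= f t) -> d <= 0.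
Proof.
  intros Hd Hat Hm.
  assert (0 <= - d); [|lra].
  apply (derive_nonneg_at_left_max (fun x => f (- x)) (- b) (- t)).
  - replace (- d) with (scal (-1) d) by (unfold scal; simpl; unfold mult; simpl; ring).
    apply (is_derive_comp f (fun x => - x)).
    + now rewrite Ropp_involutive.
    + auto_derive; [trivial|ring].
  - lra.
  - intros x Hx. rewrite Ropp_involutive. apply Hm; lra.
Qed.

(* No differentiability at [0] is assumed: there the equations below are singular. *)
Lemma max_principle (phi d : R -> R) (u v c : R) :
  u <= 0 <= v ->
  (forall y, u <= y <= v -> continuous phi y) ->
  (forall y, u <= y <= v -> y <> 0 -> is_derive phi y (d y)) ->
  (forall y, u <= y <= v -> y <> 0 -> 0 <= y * d y -> phi y <= c) ->
  phi 0 <= c ->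
  forall y, u <= y <= v -> phi y <= c.
Proof.
  intros Huv Hc Hd Hs H0 y Hy.
  destruct (continuous_max_on phi u v) as [t [Ht Hm]]; [lra|assumption|].
  apply Rle_trans with (phi t); [now apply Hm|].
  (* A maximum at [t <> 0] is in particular a maximum over the segment from [0] to [t], so
     [0 <= t * d t] even if [t] is [u] or [v]. Hence no boundary values enter. *)
  destruct (Rtotal_order t 0) as [Hlt|[->|Hgt]]; [|assumption|].
  - apply Hs; [lra|lra|].
    assert (d t <= 0).
    { apply (derive_nonpos_at_right_max phi 0 t); [apply Hd; lra|lra|].
      intros x Hx; apply Hm; lra. }
    nra.
  - apply Hs; [lra|lra|].
    assert (0 <= d t).
    { apply (derive_nonneg_at_left_max phi 0 t); [apply Hd; lra|lra|].
      intros x Hx; apply Hm; lra. }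
    nra.
Qed.

Lemma pow2_le_Rabs (x y : R) : 0 <= y -> x ^ 2 <= y ^ 2 -> Rabs x <= y.
Proof. intros Hy H. apply Rabs_le. split; nra. Qed.

(** The sign condition says [K V^2 <= V s], hence [|V| <= |s| / K <= M]. *)
Lemma damping_bound (V K s kappa M : R) :
  0 < kappa <= K -> Rabs s <= kappa * M -> 0 <= V * (- K * V + s) -> Rabs V <= M.
Proof.
  intros HK Hs HV.
  assert (HVs : V * s <= Rabs V * (kappa * M)).
  { eapply Rle_trans; [apply Rle_abs|]. rewrite Rabs_mult.
    apply Rmult_le_compat_l; [apply Rabs_pos|assumption]. }
  assert (H2 : V * V = Rabs V * Rabs V) by (rewrite <- Rabs_mult, Rabs_pos_eq; nra).
  assert (Hp := Rabs_pos V). assert (Hsp := Rabs_pos s).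
  assert (HM : 0 <= M) by nra.
  apply Rnot_lt_le. intros Hlt.
  assert (0 < Rabs V) by lra.
  assert (kappa * (Rabs V * Rabs V) <= Rabs V * (kappa * M)) by nra.
  assert (0 < kappa * Rabs V) by nra.
  nra.
Qed.

(** For a singular equation [m V' = q] whose coefficient [m] has the sign of [y]: outward growth at
    an extremum becomes a sign of [q]. *)
Lemma mult_sign_transfer (y m q : R) : 0 < y * m -> 0 <= y * (q / m) -> 0 <= q.
Proof.
  intros Hm Hq.
  assert (m <> 0) by (intros ->; lra). assert (y <> 0) by (intros ->; lra).
  assert (0 <= y * (q / m) * (y * m)) by nra.
  replace (y * (q / m) * (y * m)) with (y ^ 2 * q) in H1 by (field; assumption).
  assert (0 < y ^ 2) by (apply pow2_gt_0; assumption). nra.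
Qed.

(** Because [m] changes sign at [0], the equation [m V' = - K V + s] damps [V] outward on both
    sides, and at [0] it degenerates to [K V = s]. The forcing alone therefore bounds [V], by the
    maximum principle for [V ^ 2]. *)
Lemma damped_bound (V dV K s m : R -> R) (u v kappa M : R) :
  u <= 0 <= v -> 0 < kappa ->
  (forall y, u <= y <= v -> continuous V y) ->
  (forall y, u <= y <= v -> y <> 0 -> is_derive V y (dV y)) ->
  (forall y, u <= y <= v -> y <> 0 -> 0 < y * m y) -> m 0 = 0 ->
  (forall y, u <= y <= v -> m y * dV y = - K y * V y + s y) ->
  (forall y, u <= y <= v -> kappa <= K y) ->
  (forall y, u <= y <= v -> Rabs (s y) <= kappa * M) ->
  forall y, u <= y <= v -> Rabs (V y) <= M.
Proof.
  intros Huv Hkap Hc Hd Hm Hm0 Heq HK Hs y Hy.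
  assert (HM : 0 <= M).
  { assert (H := Hs 0 Huv). assert (H0 := Rabs_pos (s 0)). nra. }
  apply pow2_le_Rabs; [assumption|].
  apply (max_principle (fun y => V y ^ 2) (fun y => 2 * V y * dV y) u v); [assumption| | | | |assumption].
  - intros z Hz. apply (continuous_comp V (fun x => x ^ 2)); [now apply Hc|].
    apply (ex_derive_continuous (V := R_NormedModule)). auto_derive. trivial.
  - intros z Hz Hz0. assert (HD := Hd z Hz Hz0).
    auto_derive; [now exists (dV z)|].
    replace (Derive (fun x => V x) z) with (dV z) by (symmetry; now apply is_derive_unique).
    ring.
  - intros z Hz Hz0 Hsg.
    apply pow_maj_Rabs. apply (damping_bound _ (K z) (s z) kappa);
      [split; [assumption|now apply HK]|now apply Hs|].
    rewrite <- Heq by assumption.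
    assert (Hmz := Hm z Hz Hz0).
    apply (mult_sign_transfer z (m z)); [assumption|].
    replace (z * (V z * (m z * dV z) / m z)) with (z * (2 * V z * dV z) / 2); [lra|].
    field. intros H0; rewrite H0 in Hmz; lra.
  - apply pow_maj_Rabs. apply (damping_bound _ (K 0) (s 0) kappa);
      [split; [assumption|now apply HK]|now apply Hs|].
    rewrite <- Heq, Hm0 by assumption. lra.
Qed.

(** Since [g x = 0], the difference quotient of the product is [f (x + h)] times that of [g], so
    continuity of [f] suffices. It serves at the sonic point, with [P] as [f]. *)
Lemma is_derive_mult_vanishing (f g : R -> R) (x d : R) :
  continuous f x -> is_derive g x d -> g x = 0 ->
  is_derive (fun y => f y * g y) x (f x * d).
Proof.
  intros Hf Hg Hgx.
  apply is_derive_Reals. apply is_derive_Reals in Hg.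
  apply continuity_pt_filterlim in Hf.
  intros eps Heps.
  assert (Hd := Rabs_pos d). assert (Hfx := Rabs_pos (f x)).
  set (e1 := eps / (2 * (Rabs d + 1))).
  set (e2 := Rmin 1 (eps / (2 * (Rabs (f x) + 1)))).
  assert (He1 : 0 < e1) by (apply Rdiv_lt_0_compat; lra).
  assert (He2 : 0 < e2) by (apply Rmin_glb_lt; [lra|apply Rdiv_lt_0_compat; lra]).
  destruct (Hf e1 He1) as [a1 [Ha1 H1]].
  destruct (Hg e2 He2) as [a2 H2].
  assert (Hmin : 0 < Rmin a1 a2) by (apply Rmin_glb_lt; [lra|apply cond_pos]).
  exists (mkposreal _ Hmin). intros h Hh Hlt. simpl in Hlt.
  assert (L1 := Rmin_l a1 a2). assert (L2 := Rmin_r a1 a2).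
  assert (B1 : Rabs (f (x + h) - f x) < e1).
  { apply (H1 (x + h)). split; [split; [exact I|lra]|].
    simpl. unfold Rdist. replace (x + h - x) with h by ring. lra. }
  assert (B2 := H2 h Hh ltac:(lra)).
  rewrite Hgx, Rmult_0_r.
  set (q := (g (x + h) - g x) / h) in *.
  replace ((f (x + h) * g (x + h) - 0) / h - f x * d)
    with ((f (x + h) - f x) * q + f x * (q - d)).
  2: { unfold q. rewrite Hgx. field. assumption. }
  assert (M1 : e2 <= 1) by apply Rmin_l.
  assert (M2 : e2 <= eps / (2 * (Rabs (f x) + 1))) by apply Rmin_r.
  assert (Bq : Rabs q <= Rabs d + 1).
  { replace q with ((q - d) + d) by ring.
    eapply Rle_trans; [apply Rabs_triang|]. lra. }
  eapply Rle_lt_trans; [apply Rabs_triang|]. rewrite !Rabs_mult.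
  assert (e1 * (Rabs d + 1) = eps / 2) by (unfold e1; field; lra).
  assert (eps / (2 * (Rabs (f x) + 1)) * (Rabs (f x) + 1) = eps / 2) by (field; lra).
  assert (0 <= Rabs q) by apply Rabs_pos.
  assert (0 <= Rabs (q - d)) by apply Rabs_pos.
  assert (Rabs (f (x + h) - f x) * Rabs q <= e1 * (Rabs d + 1)).
  { apply Rmult_le_compat; try apply Rabs_pos; lra. }
  assert (Rabs (f x) * Rabs (q - d) < (Rabs (f x) + 1) * (eps / (2 * (Rabs (f x) + 1)))).
  { nra. }
  lra.
Qed.

Lemma ivt (f : R -> R) (a b c : R) :
  (forall x, continuous f x) -> a <= b -> (f a <= c <= f b) ->
  exists t, a <= t <= b /\ f t = c.
Proof.
  intros Hf Hab Hc.
  destruct (IVT_gen_consistent f a b c) as [t [Ht1 Ht2]]; [assumption| |].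
  - rewrite Rmin_left, Rmax_right; lra.
  - rewrite Rmin_left, Rmax_right in Ht1 by lra. now exists t.
Qed.

Lemma mean_value (f d : R -> R) (a b : R) :
  a < b -> (forall x, a <= x <= b -> continuous f x) ->
  (forall x, a < x < b -> is_derive f x (d x)) ->
  exists c, a < c < b /\ f b - f a = d c * (b - a).
Proof.
  intros Hab Hc Hd.
  assert (Hpr : forall c, a < c < b -> derivable_pt f c).
  { intros c Hc'. exists (d c). apply is_derive_Reals. now apply Hd. }
  destruct (MVT f id a b Hpr (fun c _ => derivable_pt_id c) Hab) as [c [Hc' He]].
  - intros x Hx. apply continuity_pt_filterlim. now apply Hc.
  - intros x Hx. apply derivable_continuous_pt, derivable_pt_id.
  - exists c. split; [assumption|].
    assert (E1 : derive_pt f c (Hpr c Hc') = d c).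
    { apply derive_pt_eq_0, is_derive_Reals. now apply Hd. }
    assert (E2 : derive_pt id c (derivable_pt_id c) = 1).
    { apply derive_pt_eq_0, derivable_pt_lim_id. }
    rewrite E1, E2 in He. unfold id in He. lra.
Qed.

Lemma lipschitz_of_derive (f d : R -> R) (K a b : R) :
  a <= b -> (forall x, a <= x <= b -> continuous f x) ->
  (forall x, a < x < b -> is_derive f x (d x)) ->
  (forall x, a < x < b -> Rabs (d x) <= K) ->
  Rabs (f b - f a) <= K * (b - a).
Proof.
  intros Hab Hc Hd HK.
  destruct (Req_dec a b) as [->|Hne].
  { rewrite !Rminus_diag, Rabs_R0. lra. }
  destruct (mean_value f d a b) as [c [Hc' He]]; [lra|assumption|assumption|].
  rewrite He, Rabs_mult, (Rabs_pos_eq (b - a)) by lra.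
  apply Rmult_le_compat_r; [lra|now apply HK].
Qed.

(** Continuity at [0] lets the estimates on the two sides be added. This is how [P] is handled
    across the sonic point. *)
Lemma lipschitz_of_derive_but_0 (f d : R -> R) (K a b : R) :
  a <= b -> (forall x, a <= x <= b -> continuous f x) ->
  (forall x, a < x < b -> x <> 0 -> is_derive f x (d x)) ->
  (forall x, a < x < b -> x <> 0 -> Rabs (d x) <= K) ->
  Rabs (f b - f a) <= K * (b - a).
Proof.
  intros Hab Hc Hd HK.
  destruct (Rle_lt_dec b 0); [|destruct (Rle_lt_dec 0 a)].
  - apply lipschitz_of_derive with d; intros; try apply Hc; try apply Hd; try apply HK; lra.
  - apply lipschitz_of_derive with d; intros; try apply Hc; try apply Hd; try apply HK; lra.
  - assert (Rabs (f 0 - f a) <= K * (0 - a)).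
    { apply lipschitz_of_derive with d; intros; try apply Hc; try apply Hd; try apply HK; lra. }
    assert (Rabs (f b - f 0) <= K * (b - 0)).
    { apply lipschitz_of_derive with d; intros; try apply Hc; try apply Hd; try apply HK; lra. }
    replace (f b - f a) with ((f b - f 0) + (f 0 - f a)) by ring.
    eapply Rle_trans; [apply Rabs_triang|]. lra.
Qed.

Lemma closed_bound (f : R -> R) (K a b : R) :
  a < b -> (forall x, a <= x <= b -> continuous f x) ->
  (forall x, a < x < b -> f x <= K) -> forall x, a <= x <= b -> f x <= K.
Proof.
  intros Hab Hc HK x Hx.
  apply Rnot_lt_le. intros Hlt.
  assert (Hloc := Hc x Hx (fun z => K < z)).
  assert (H1 : locally x (fun y => K < f y)).
  { apply Hloc. exists (mkposreal (f x - K) ltac:(lra)). intros z Hz.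
    unfold ball in Hz; simpl in Hz; unfold AbsRing_ball in Hz; simpl in Hz.
    unfold abs, minus, plus, opp in Hz; simpl in Hz. apply Rabs_def2 in Hz. lra. }
  destruct H1 as [e He].
  assert (Hep := cond_pos e).
  set (h := Rmin (e / 2) ((b - a) / 3)).
  assert (0 < h) by (apply Rmin_glb_lt; lra).
  assert (h <= e / 2) by apply Rmin_l.
  assert (h <= (b - a) / 3) by apply Rmin_r.
  assert (Hball : forall y, Rabs (y - x) < e -> K < f y).
  { intros y Hy. apply He. exact Hy. }
  destruct (Rle_lt_dec x ((a + b) / 2)).
  - assert (K < f (x + h)) by (apply Hball; rewrite Rabs_pos_eq; lra).
    assert (f (x + h) <= K) by (apply HK; lra). lra.
  - assert (K < f (x - h)) by (apply Hball; rewrite Rabs_left1; lra).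
    assert (f (x - h) <= K) by (apply HK; lra). lra.
Qed.

(** [f e^(-K x)] decreases and [f e^(K x)] increases. The second half propagates bounds to the left,
    as the supersonic side requires. *)
Lemma gronwall (f d : R -> R) (K a b : R) :
  a <= b -> (forall x, a <= x <= b -> is_derive f x (d x)) ->
  (forall x, a <= x <= b -> Rabs (d x) <= K * f x) ->
  f b <= f a * exp (K * (b - a)) /\ f a <= f b * exp (K * (b - a)).
Proof.
  intros Hab Hd HK.
  destruct (Req_dec a b) as [->|Hne].
  { rewrite !Rminus_diag, Rmult_0_r, exp_0. lra. }
  split.
  - destruct (mean_value (fun x => f x * exp (- (K * (x - a))))
       (fun x => (d x - K * f x) * exp (- (K * (x - a)))) a b) as [c [Hc He]]; [lra| | |].
    + intros x Hx. apply (ex_derive_continuous (V := R_NormedModule)).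
      auto_derive. repeat split. exists (d x). now apply Hd.
    + intros x Hx. assert (Hdx : is_derive f x (d x)) by (apply Hd; lra).
      auto_derive.
      * now exists (d x).
      * replace (Derive (fun x0 => f x0) x) with (d x) by (symmetry; now apply is_derive_unique).
        unfold Rminus; ring.
    + assert (Hc' := HK c ltac:(lra)). apply Rabs_le_between in Hc'.
      assert (Hp := exp_pos (- (K * (c - a)))).
      rewrite (Rminus_diag a), Rmult_0_r, Ropp_0, exp_0, Rmult_1_r in He.
      assert (f b * exp (- (K * (b - a))) <= f a).
      { assert ((d c - K * f c) * exp (- (K * (c - a))) <= 0) by nra. nra. }
      rewrite exp_Ropp in H.
      assert (Hpb := exp_pos (K * (b - a))).
      apply (Rmult_le_compat_r (exp (K * (b - a)))) in H; [|lra].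
      rewrite Rmult_assoc, Rinv_l in H; lra.
  - destruct (mean_value (fun x => f x * exp (K * (x - a)))
       (fun x => (d x + K * f x) * exp (K * (x - a))) a b) as [c [Hc He]]; [lra| | |].
    + intros x Hx. apply (ex_derive_continuous (V := R_NormedModule)).
      auto_derive. repeat split. exists (d x). now apply Hd.
    + intros x Hx. assert (Hdx : is_derive f x (d x)) by (apply Hd; lra).
      auto_derive.
      * now exists (d x).
      * replace (Derive (fun x0 => f x0) x) with (d x) by (symmetry; now apply is_derive_unique).
        unfold Rminus; ring.
    + assert (Hc' := HK c ltac:(lra)). apply Rabs_le_between in Hc'.
      assert (Hp := exp_pos (K * (c - a))).
      rewrite (Rminus_diag a), Rmult_0_r, exp_0, Rmult_1_r in He.
      assert (0 <= (d c + K * f c) * exp (K * (c - a))) by nra. nra.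
Qed.

(** * Automatic bounds and continuity for polynomial expressions *)

Lemma Rabs_add_le (x y a b : R) : Rabs x <= a -> Rabs y <= b -> Rabs (x + y) <= a + b.
Proof. intros. eapply Rle_trans; [apply Rabs_triang|]. lra. Qed.

Lemma Rabs_sub_le (x y a b : R) : Rabs x <= a -> Rabs y <= b -> Rabs (x - y) <= a + b.
Proof. intros. apply Rabs_add_le; [assumption|]. now rewrite Rabs_Ropp. Qed.

Lemma Rabs_mult_le (x y a b : R) : Rabs x <= a -> Rabs y <= b -> Rabs (x * y) <= a * b.
Proof.
  intros. rewrite Rabs_mult. apply Rmult_le_compat; try apply Rabs_pos; assumption.
Qed.

Lemma Rabs_pow_le (x a : R) (k : nat) : Rabs x <= a -> Rabs (x ^ k) <= a ^ k.
Proof.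
  intros. rewrite <- RPow_abs. apply pow_incr. split; [apply Rabs_pos|assumption].
Qed.

Lemma Rabs_inv_le (x e : R) : 0 < e -> e <= Rabs x -> Rabs (/ x) <= / e.
Proof. intros He Hx. rewrite Rabs_inv. now apply Rinv_le_contravar. Qed.

(* Solves [Rabs e <= ?C] for an arithmetic expression [e], building [?C] from bounds on the atoms. *)
Ltac bound_Rabs :=
  lazymatch goal with
  | |- Rabs (_ + _) <= _ => eapply Rabs_add_le; bound_Rabs
  | |- Rabs (_ - _) <= _ => eapply Rabs_sub_le; bound_Rabs
  | |- Rabs (_ * _) <= _ => eapply Rabs_mult_le; bound_Rabs
  | |- Rabs (_ ^ _) <= _ => eapply Rabs_pow_le; bound_Rabs
  | |- Rabs (- _) <= _ => rewrite Rabs_Ropp; bound_Rabs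
  | |- _ => first [eassumption | apply Rle_refl]
  end.

Ltac prove_continuous :=
  lazymatch goal with
  | |- continuous (fun y => @?f y + @?g y) _ =>
      apply (continuous_plus (V := R_NormedModule) f g); prove_continuous
  | |- continuous (fun y => @?f y - @?g y) _ =>
      apply (continuous_minus (V := R_NormedModule) f g); prove_continuous
  | |- continuous (fun y => @?f y * @?g y) _ =>
      apply (continuous_mult (K := R_AbsRing) f g); prove_continuous
  | |- continuous (fun y => @?f y ^ ?m) _ =>
      apply (continuous_comp f (fun x => x ^ m)); [prove_continuous|
        apply (ex_derive_continuous (V := R_NormedModule)); auto_derive; trivial]
  | |- continuous (fun y => Rabs (@?f y)) _ =>
      apply (continuous_comp f Rabs); [prove_continuous|apply continuous_Rabs]
  | |- continuous (fun _ => ?c) _ => apply continuous_const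
  | |- _ => idtac
  end.

(** * A single translated solution *)

Ltac derive_hyps :=
  repeat match goal with
  | H : is_derive ?f ?x ?l |- _ =>
      lazymatch goal with
      | _ : ex_derive f x |- _ => fail
      | _ => assert (ex_derive f x) by (exists l; exact H);
             assert (Derive f x = l) by (apply is_derive_unique; exact H)
      end
  end.

Ltac split_conj := repeat match goal with |- _ /\ _ => split end; try assumption; try exact I.

Ltac rewrite_derive :=
  repeat match goal with
  | H : Derive ?f ?x = ?l |- context [Derive ?g ?x] =>
      change (Derive g x) with (Derive f x); rewrite H
  end.

Section Flow.

Context (J L alpha k r : R).
Hypotheses (HJ : 0 < J) (HL : 0 < L) (Halpha : 0 <= alpha) (Hk : J / 2 <= k < J) (Hr : J <= r).

(* A solution translated so that the sonic point is [0]; outside [[-A, B]] only [n' = P] and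
   [E' = n - b] are required, so that both hold at the endpoints as two-sided derivatives. *)
Record flow (b A B : R) (n E P : R -> R) : Prop := {
  flow_A : 0 < A;
  flow_B : 0 < B;
  flow_AB : A + B = L;
  flow_b : 0 < b <= k;
  flow_P : forall y, continuous P y;
  flow_n : forall y, is_derive n y (P y);
  flow_E : forall y, is_derive E y (n y - b);
  flow_ode : forall y, -A <= y <= B ->
    P y * (n y ^ 2 - J ^ 2) = (n y * E y - alpha * J) * n y ^ 2;
  flow_pos : forall y, -A <= y <= B -> 0 < n y;
  flow_super : forall y, -A <= y < 0 -> n y < J;
  flow_sonic : n 0 = J;
  flow_sub : forall y, 0 < y <= B -> J < n y;
  flow_left : n (-A) <= k;
  flow_right : n B <= r }.

Definition mu (m : R) := m * (m ^ 2 - J ^ 2).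
(** Obtained by differentiating the equation of [flow_ode], multiplying by [- n / P ^ 2], and
    replacing [E] by its value from the equation itself. Only [n], [b] and [Z] remain. *)
Definition rate (b m Z : R) :=
  3 * J ^ 2 - m ^ 2 - alpha * J * m ^ 2 * Z - m ^ 4 * (m - b) * Z ^ 2.

Lemma mu_sign (m : R) : 0 < m -> (J < m -> 0 < mu m) /\ (m < J -> mu m < 0).
Proof.
  unfold mu. intros Hm. split; intros H.
  - apply Rmult_lt_0_compat; [assumption|nra].
  - assert (0 < J ^ 2 - m ^ 2) by nra. nra.
Qed.

Section Single.

Context (b A B : R) (n E P : R -> R) (F : flow b A B n E P).

Local Lemma cont_n y : continuous n y.
Proof. apply (ex_derive_continuous (V := R_NormedModule)). exists (P y). exact (flow_n _ _ _ _ _ _ F y). Qed.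

Local Lemma cont_E y : continuous E y.
Proof. apply (ex_derive_continuous (V := R_NormedModule)). eexists. exact (flow_E _ _ _ _ _ _ F y). Qed.

Lemma flow_E0 : E 0 = alpha.
Proof.
  assert (HA := flow_A _ _ _ _ _ _ F). assert (HB := flow_B _ _ _ _ _ _ F).
  assert (H := flow_ode _ _ _ _ _ _ F 0 ltac:(lra)).
  rewrite (flow_sonic _ _ _ _ _ _ F) in H.
  assert (0 < J ^ 2) by nra.
  assert (J * (E 0 - alpha) * J ^ 2 = 0) by nra.
  apply Rmult_integral in H1. destruct H1; [|lra].
  apply Rmult_integral in H1. destruct H1; lra.
Qed.

Lemma flow_E_sub y : 0 <= y <= B -> alpha + (J - k) * y <= E y.
Proof.
  intros Hy. destruct (Req_dec y 0) as [->|Hne]; [rewrite flow_E0; lra|].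
  destruct (mean_value E (fun y => n y - b) 0 y) as [c [Hc He]]; [lra| | |].
  - intros; apply cont_E.
  - intros x Hx; exact (flow_E _ _ _ _ _ _ F x).
  - rewrite flow_E0 in He.
    assert (J < n c) by (apply (flow_sub _ _ _ _ _ _ F); lra).
    assert (b <= k) by exact (proj2 (flow_b _ _ _ _ _ _ F)). nra.
Qed.

(** On the subsonic side [E] grows from [alpha] and [n] exceeds [J], so [n E - alpha J] is
    positive. *)
Lemma flow_P_sub y : 0 < y <= B -> 0 < P y.
Proof.
  intros Hy.
  assert (HA := flow_A _ _ _ _ _ _ F).
  assert (H := flow_ode _ _ _ _ _ _ F y ltac:(lra)).
  assert (Hn := flow_sub _ _ _ _ _ _ F y Hy).
  assert (HE := flow_E_sub y ltac:(lra)).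
  assert (0 < (J - k) * y) by nra.
  assert (0 < n y * E y - alpha * J) by nra.
  assert (0 < n y ^ 2) by nra.
  assert (0 < n y ^ 2 - J ^ 2) by nra.
  assert (0 < (n y * E y - alpha * J) * n y ^ 2) by nra.
  nra.
Qed.

(** Differentiating the equation at [0], where [P] is multiplied by a vanishing factor, gives
    [2 P^2 = J (alpha P + J (J - b))]. Its roots have opposite signs since [b < J], and positivity
    of [P] on the subsonic side selects the positive one. *)
Lemma flow_rate_0 : 0 < P 0 /\ rate b (n 0) (/ P 0) = 0.
Proof.
  assert (HA := flow_A _ _ _ _ _ _ F). assert (HB := flow_B _ _ _ _ _ _ F).
  assert (Hb := flow_b _ _ _ _ _ _ F).
  assert (Hn0 := flow_sonic _ _ _ _ _ _ F).
  assert (HnD := flow_n _ _ _ _ _ _ F 0). assert (HED := flow_E _ _ _ _ _ _ F 0).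
  assert (D1 : is_derive (fun y => P y * (n y ^ 2 - J ^ 2)) 0 (P 0 * (2 * J * P 0))).
  { apply is_derive_mult_vanishing.
    - exact (flow_P _ _ _ _ _ _ F 0).
    - derive_hyps. auto_derive; [assumption|]. rewrite_derive. rewrite Hn0. ring.
    - rewrite Hn0; ring. }
  assert (D2 : is_derive (fun y => (n y * E y - alpha * J) * n y ^ 2) 0
                 (J ^ 2 * (P 0 * alpha + J * (J - b)))).
  { derive_hyps. auto_derive; [tauto|]. rewrite_derive. rewrite Hn0, flow_E0. ring. }
  assert (Heq : P 0 * (2 * J * P 0) = J ^ 2 * (P 0 * alpha + J * (J - b))).
  { rewrite <- (is_derive_unique _ _ _ D1). apply is_derive_unique.
    eapply is_derive_ext_loc; [|exact D2].
    assert (Hm : 0 < Rmin A B) by (apply Rmin_glb_lt; lra).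
    exists (mkposreal _ Hm). intros y Hy. simpl.
    unfold ball in Hy; simpl in Hy; unfold AbsRing_ball, abs, minus, plus, opp in Hy; simpl in Hy.
    assert (L1 := Rmin_l A B). assert (L2 := Rmin_r A B).
    apply Rabs_def2 in Hy. symmetry. apply (flow_ode _ _ _ _ _ _ F). lra. }
  assert (Hge : 0 <= P 0).
  { assert (- P 0 <= 0); [|lra].
    apply (closed_bound (fun y => - P y) 0 0 B); [lra| | |lra].
    - intros x Hx. apply (continuous_opp (V := R_NormedModule) P). exact (flow_P _ _ _ _ _ _ F x).
    - intros x Hx. assert (0 < P x) by (apply flow_P_sub; lra). lra. }
  assert (0 < P 0).
  { destruct (Rle_lt_or_eq_dec _ _ Hge) as [|He]; [assumption|].
    rewrite <- He in Heq. assert (0 < J ^ 2 * (J * (J - b))).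
    { repeat apply Rmult_lt_0_compat; nra. } lra. }
  split; [assumption|].
  unfold rate. rewrite Hn0.
  apply (Rmult_eq_reg_r (P 0 ^ 2)); [|nra].
  rewrite Rmult_0_l.
  replace ((3 * J ^ 2 - J ^ 2 - alpha * J * J ^ 2 * / P 0 - J ^ 4 * (J - b) * (/ P 0) ^ 2) * P 0 ^ 2)
    with (J * (P 0 * (2 * J * P 0) - J ^ 2 * (P 0 * alpha + J * (J - b)))) by (field; lra).
  rewrite Heq; ring.
Qed.

Lemma flow_sq_neq y : -A <= y <= B -> y <> 0 -> n y ^ 2 - J ^ 2 <> 0.
Proof.
  intros Hy Hy0.
  assert (Hp := flow_pos _ _ _ _ _ _ F y Hy).
  destruct (Rtotal_order y 0) as [H|[H|H]]; [|lra|].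
  - assert (n y < J) by (apply (flow_super _ _ _ _ _ _ F); lra). nra.
  - assert (J < n y) by (apply (flow_sub _ _ _ _ _ _ F); lra). nra.
Qed.

Lemma flow_P_eq y : -A <= y <= B -> y <> 0 ->
  P y = (n y * E y - alpha * J) * n y ^ 2 / (n y ^ 2 - J ^ 2).
Proof.
  intros Hy Hy0. rewrite <- (flow_ode _ _ _ _ _ _ F y Hy).
  field. now apply flow_sq_neq.
Qed.

(** The quotient rule applied to the right-hand side of [flow_P_eq], with [m], [e], [p] standing for
    the values of [n], [E], [P]. *)
Definition dP (b m e p : R) :=
  (2 * m * p * (m * e - alpha * J) + m ^ 2 * (p * e + m * (m - b))) / (m ^ 2 - J ^ 2)
  - (m * e - alpha * J) * m ^ 2 * (2 * m * p) / (m ^ 2 - J ^ 2) ^ 2.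

Lemma flow_dP y : -A < y < B -> y <> 0 -> is_derive P y (dP b (n y) (E y) (P y)).
Proof.
  intros Hy Hy0.
  apply (is_derive_ext_loc (fun y => (n y * E y - alpha * J) * n y ^ 2 / (n y ^ 2 - J ^ 2))).
  - set (e := Rmin (Rabs y) (Rmin (y + A) (B - y))).
    assert (He : 0 < e).
    { repeat apply Rmin_glb_lt; try lra. now apply Rabs_pos_lt. }
    assert (L1 : e <= Rabs y) by apply Rmin_l.
    assert (L2 : e <= y + A) by (eapply Rle_trans; [apply Rmin_r|apply Rmin_l]).
    assert (L3 : e <= B - y) by (eapply Rle_trans; [apply Rmin_r|apply Rmin_r]).
    exists (mkposreal _ He). intros z Hz.
    unfold ball in Hz; simpl in Hz; unfold AbsRing_ball, abs, minus, plus, opp in Hz; simpl in Hz.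
    symmetry. apply flow_P_eq.
    + apply Rabs_def2 in Hz. lra.
    + intros ->. rewrite Rplus_0_l, Rabs_Ropp in Hz. lra.
  - assert (Hs := flow_sq_neq y ltac:(lra) Hy0).
    assert (HnD := flow_n _ _ _ _ _ _ F y). assert (HED := flow_E _ _ _ _ _ _ F y).
    derive_hyps. auto_derive.
    + split_conj.
    + rewrite_derive. unfold dP. field. assumption.
Qed.

Lemma flow_dZ y : -A < y < B -> y <> 0 -> P y <> 0 ->
  is_derive (fun y => / P y) y (rate b (n y) (/ P y) / mu (n y)).
Proof.
  intros Hy Hy0 HP.
  assert (Hs := flow_sq_neq y ltac:(lra) Hy0).
  assert (Hp := flow_pos _ _ _ _ _ _ F y ltac:(lra)).
  assert (HD := flow_dP y Hy Hy0).
  assert (Ho := flow_ode _ _ _ _ _ _ F y ltac:(lra)).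
  replace (rate b (n y) (/ P y) / mu (n y)) with (- dP b (n y) (E y) (P y) / P y ^ 2).
  - apply is_derive_inv; assumption.
  - assert (HE : E y = (P y * (n y ^ 2 - J ^ 2) / n y ^ 2 + alpha * J) / n y).
    { rewrite Ho. field. lra. }
    unfold dP, rate, mu. rewrite HE. field. split_conj; lra.
Qed.

Lemma flow_mu_sign y : -A <= y <= B -> y <> 0 -> 0 < y * mu (n y).
Proof.
  intros Hy Hy0.
  assert (Hp := flow_pos _ _ _ _ _ _ F y Hy).
  destruct (mu_sign (n y) Hp) as [H1 H2].
  destruct (Rtotal_order y 0) as [H|[H|H]]; [|lra|].
  - assert (mu (n y) < 0) by (apply H2, (flow_super _ _ _ _ _ _ F); lra). nra.
  - assert (0 < mu (n y)) by (apply H1, (flow_sub _ _ _ _ _ _ F); lra). nra.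
Qed.

(* The energy [(E - alpha J / n)^2 / 2 - G n] with
   [G' n = (n - b) (n^2 - J^2) / n^3] decreases along the supersonic branch, and [G] decreases
   on [[b, J]]: a critical point of [n] with [n >= b] would have less energy than the sonic point. *)
Lemma flow_critical_lt y : -A < y < 0 -> P y = 0 -> n y < b.
Proof.
  intros Hy HP.
  apply Rnot_le_lt. intros Hb.
  assert (HA := flow_A _ _ _ _ _ _ F). assert (HB := flow_B _ _ _ _ _ _ F).
  assert (Hb' := flow_b _ _ _ _ _ _ F).
  assert (Hn0 := flow_sonic _ _ _ _ _ _ F).
  set (G := fun m => m - b * ln m + J ^ 2 / m - b * J ^ 2 / (2 * m ^ 2)).
  assert (HG : forall m, 0 < m -> is_derive G m ((m - b) * (m ^ 2 - J ^ 2) / m ^ 3)).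
  { intros m Hm. unfold G. auto_derive.
    - split_conj; try lra. nra.
    - field. lra. }
  assert (Hlt : n y < J) by (apply (flow_super _ _ _ _ _ _ F); lra).
  assert (G1 : G J < G (n y)).
  { destruct (mean_value G (fun m => (m - b) * (m ^ 2 - J ^ 2) / m ^ 3) (n y) J)
      as [c [Hc He]]; [lra| | |].
    - intros m Hm. apply (ex_derive_continuous (V := R_NormedModule)).
      eexists. apply HG. lra.
    - intros m Hm. apply HG. lra.
    - assert (0 < c ^ 3) by (apply pow_lt; lra).
      assert ((c - b) * (c ^ 2 - J ^ 2) / c ^ 3 < 0).
      { replace ((c - b) * (c ^ 2 - J ^ 2) / c ^ 3) with (- ((c - b) * (J ^ 2 - c ^ 2) / c ^ 3))
          by (field; lra).
        assert (0 < (c - b) * (J ^ 2 - c ^ 2) / c ^ 3); [|lra].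
        apply Rdiv_lt_0_compat; [|assumption]. apply Rmult_lt_0_compat; nra. }
      nra. }
  set (H := fun z => (E z - alpha * J / n z) ^ 2 / 2 - G (n z)).
  set (dH := fun z => (E z - alpha * J / n z) * (n z - b + alpha * J * P z / n z ^ 2)
                      - P z * ((n z - b) * (n z ^ 2 - J ^ 2) / n z ^ 3)).
  assert (HH : forall z, -A <= z <= B -> is_derive H z (dH z)).
  { intros z Hz. assert (Hp := flow_pos _ _ _ _ _ _ F z Hz).
    assert (HnD := flow_n _ _ _ _ _ _ F z). assert (HED := flow_E _ _ _ _ _ _ F z).
    assert (HGD : is_derive (fun z => G (n z)) z (P z * ((n z - b) * (n z ^ 2 - J ^ 2) / n z ^ 3))).
    { apply (is_derive_comp G n); [now apply HG|assumption]. }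
    apply (is_derive_minus (fun z => (E z - alpha * J / n z) ^ 2 / 2)); [|assumption].
    derive_hyps. auto_derive.
    - split_conj; lra.
    - rewrite_derive. field. lra. }
  destruct (mean_value H dH y 0) as [c [Hc He]]; [lra| | |].
  - intros z Hz. apply (ex_derive_continuous (V := R_NormedModule)).
    eexists. apply HH. lra.
  - intros z Hz. apply HH. lra.
  - assert (HdH : dH c <= 0).
    { assert (Hp := flow_pos _ _ _ _ _ _ F c ltac:(lra)).
      assert (HPc := flow_P_eq c ltac:(lra) ltac:(lra)).
      assert (Hs := flow_sq_neq c ltac:(lra) ltac:(lra)).
      assert (Hlc : n c < J) by (apply (flow_super _ _ _ _ _ _ F); lra).
      (* With [w = E - alpha J / n], the equation reads [P = n^3 w / (n^2 - J^2)], so the derivative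
         of [G n] equals [w (n - b)] and cancels. Only the dissipation due to relaxation is left. *)
      assert (HdHc : dH c = - (alpha * J * (E c - alpha * J / n c) ^ 2 * n c / (J ^ 2 - n c ^ 2))).
      { unfold dH. rewrite HPc. field. split_conj; lra. }
      rewrite HdHc.
      assert (0 <= alpha * J * (E c - alpha * J / n c) ^ 2 * n c / (J ^ 2 - n c ^ 2)); [|lra].
      apply Rmult_le_pos.
      - apply Rmult_le_pos; [|lra]. apply Rmult_le_pos; [nra|apply pow2_ge_0].
      - left. apply Rinv_0_lt_compat. nra. }
    assert (Ho := flow_ode _ _ _ _ _ _ F y ltac:(lra)).
    assert (Hp := flow_pos _ _ _ _ _ _ F y ltac:(lra)).
    assert (HEy : E y - alpha * J / n y = 0).
    { rewrite HP, Rmult_0_l in Ho. symmetry in Ho. apply Rmult_integral in Ho.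
      destruct Ho as [Ho|Ho]; [|nra].
      replace (E y - alpha * J / n y) with ((n y * E y - alpha * J) / n y) by (field; lra).
      rewrite Ho. field. lra. }
    assert (HE0 : E 0 - alpha * J / n 0 = 0) by (rewrite flow_E0, Hn0; field; lra).
    unfold H in He. rewrite HEy, HE0, Hn0 in He. nra.
Qed.

(** If [P z <= 0], then [n] has a maximum over [[-A, z]] with value above [k]. It is not at [-A],
    where [n <= k], so it is a critical point with [n > k >= b], contrary to [flow_critical_lt]. *)
Lemma flow_increasing_above y : -A <= y < 0 -> k < n y ->
  forall z, y <= z <= 0 -> 0 < P z.
Proof.
  intros Hy Hny z Hz.
  assert (HA := flow_A _ _ _ _ _ _ F). assert (HB := flow_B _ _ _ _ _ _ F).
  assert (Hb := flow_b _ _ _ _ _ _ F). assert (Hl := flow_left _ _ _ _ _ _ F).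
  apply Rnot_le_lt. intros HPz.
  assert (Hz0 : z < 0).
  { destruct (Req_dec z 0) as [->|]; [|lra]. destruct flow_rate_0. lra. }
  destruct (continuous_max_on n (-A) z) as [t [Ht Hm]]; [lra|intros; apply cont_n|].
  assert (k < n t) by (specialize (Hm y); lra).
  assert (t <> -A) by (intros ->; lra).
  assert (HPt : 0 <= P t).
  { apply (derive_nonneg_at_left_max n (-A) t); [exact (flow_n _ _ _ _ _ _ F t)|lra|]. intros; apply Hm; lra. }
  assert (P t = 0).
  { destruct (Req_dec t z) as [->|]; [lra|].
    assert (P t <= 0); [|lra].
    apply (derive_nonpos_at_right_max n z t); [exact (flow_n _ _ _ _ _ _ F t)|lra|]. intros; apply Hm; lra. }
  assert (n t < b) by (apply flow_critical_lt; lra).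
  lra.
Qed.

Lemma flow_increasing y z : y <= z -> (forall t, y <= t <= z -> 0 < P t) -> n y <= n z.
Proof.
  intros Hyz HP. destruct (Req_dec y z) as [->|]; [lra|].
  destruct (mean_value n P y z) as [c [Hc He]]; [lra| | |].
  - intros; apply cont_n.
  - intros x Hx; exact (flow_n _ _ _ _ _ _ F x).
  - specialize (HP c ltac:(lra)). nra.
Qed.

Lemma flow_n_le y : -A <= y <= B -> n y <= r.
Proof.
  intros Hy. destruct (Rle_lt_dec y 0).
  - destruct (Req_dec y 0) as [->|]; [rewrite (flow_sonic _ _ _ _ _ _ F); lra|].
    assert (n y < J) by (apply (flow_super _ _ _ _ _ _ F); lra). lra.
  - apply Rle_trans with (n B); [|exact (flow_right _ _ _ _ _ _ F)].
    apply flow_increasing; [lra|]. intros t Ht. apply flow_P_sub. lra.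
Qed.

Lemma flow_E_bound y : -A <= y <= B -> Rabs (E y) <= alpha + (r + k) * L.
Proof.
  intros Hy.
  assert (HA := flow_A _ _ _ _ _ _ F). assert (HB := flow_B _ _ _ _ _ _ F).
  assert (HAB := flow_AB _ _ _ _ _ _ F). assert (Hb := flow_b _ _ _ _ _ _ F).
  assert (Hd : forall x, -A <= x <= B -> Rabs (n x - b) <= r + k).
  { intros x Hx. assert (H1 := flow_n_le x Hx).
    assert (H2 := flow_pos _ _ _ _ _ _ F x Hx). apply Rabs_le. split; lra. }
  assert (Rabs (E y - E 0) <= (r + k) * L).
  { destruct (Rle_lt_dec y 0).
    - rewrite Rabs_minus_sym. apply Rle_trans with ((r + k) * (0 - y)); [|apply Rmult_le_compat_l; lra].
      apply lipschitz_of_derive with (fun y => n y - b); [lra| | |].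
      + intros; apply cont_E.
      + intros x Hx; exact (flow_E _ _ _ _ _ _ F x).
      + intros; apply Hd; lra.
    - apply Rle_trans with ((r + k) * (y - 0)); [|apply Rmult_le_compat_l; lra].
      apply lipschitz_of_derive with (fun y => n y - b); [lra| | |].
      + intros; apply cont_E.
      + intros x Hx; exact (flow_E _ _ _ _ _ _ F x).
      + intros; apply Hd; lra. }
  replace (E y) with ((E y - E 0) + E 0) by ring.
  assert (Rabs (E 0) = alpha) by (rewrite flow_E0; now apply Rabs_pos_eq).
  eapply Rle_trans; [apply Rabs_triang|]. lra.
Qed.

End Single.

(** * Uniform estimates for one solution *)

(** In this band [n - b >= (J - k) / 2] and [3 J^2 - n^2 >= 3 J^2 / 4]. Moreover [n >= 3 J / 4]
    because [k >= J / 2], so [3 n^2 - J^2 > 0] and [mu] is increasing there. *)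
Definition near_sonic (n P : R -> R) (u v : R) :=
  forall y, u <= y <= v -> (J + k) / 2 <= n y <= 3 * J / 2 /\ 0 < P y.

(** A lower bound in the band for the coefficient [n^4 (n - b)] of [Z^2] in [rate]. It provides the
    damping even when [alpha = 0]. *)
Definition kappa0 := ((J + k) / 2) ^ 4 * ((J - k) / 2).

Lemma kappa0_pos : 0 < kappa0.
Proof. unfold kappa0. apply Rmult_lt_0_compat; [apply pow_lt|]; lra. Qed.

Lemma kappa0_le (b m : R) : b <= k -> (J + k) / 2 <= m -> kappa0 <= m ^ 4 * (m - b).
Proof.
  intros Hb Hm. unfold kappa0. apply Rmult_le_compat; [apply pow_le; lra|lra| |lra].
  apply pow_incr; lra.
Qed.

(** At a maximum of [Z] the sign [rate >= 0] caps [Z], and at a minimum [rate <= 0] keeps [Z] away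
    from [0]. At the sonic point both follow from [rate = 0]. *)
Lemma near_sonic_dxdn_bounds : exists z1 z2, 0 < z1 /\ 0 < z2 /\
  forall b A B n E P, flow b A B n E P ->
  forall u v, -A < u <= 0 -> 0 <= v < B -> near_sonic n P u v ->
  forall y, u <= y <= v -> z1 <= / P y <= z2.
Proof.
  assert (Hk0 := kappa0_pos).
  (* The first two terms bound the coefficients of [Z] and [Z^2] for [n <= 2 J]. The third gives
     [J^2 / (2 c) <= 1 / 2], so that [Z^2] is also below this threshold. Under it the negative terms
     total at most [J^2 / 2], less than [3 J^2 / 4], and [rate] is positive. *)
  set (c := 4 * alpha * J ^ 3 + 32 * J ^ 5 + J ^ 2).
  assert (0 < J ^ 2) by (apply pow_lt; lra). assert (0 < J ^ 3) by (apply pow_lt; lra).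
  assert (0 < J ^ 5) by (apply pow_lt; lra).
  assert (Hc : 0 < c) by (unfold c; nra).
  (* From [kappa0 Z^2 <= 3 J^2] the upper bound follows by [Z <= Z^2 + 1], which spares a square
     root. *)
  exists (J ^ 2 / (2 * c)), (3 * J ^ 2 / kappa0 + 1).
  assert (Hz1 : 0 < J ^ 2 / (2 * c)) by (apply Rdiv_lt_0_compat; lra).
  assert (Hz2 : 0 < 3 * J ^ 2 / kappa0) by (apply Rdiv_lt_0_compat; lra).
  split; [assumption|]. split; [lra|].
  intros b A B n E P F u v Hu Hv Hnear y Hy.
  assert (Hb := flow_b _ _ _ _ _ _ F).
  assert (HcZ : forall y, u <= y <= v -> continuous (fun y => / P y) y).
  { intros z Hz. apply continuous_Rinv_comp; [exact (flow_P _ _ _ _ _ _ F z)|].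
    destruct (Hnear z Hz). lra. }
  assert (HdZ : forall y, u <= y <= v -> y <> 0 ->
            is_derive (fun y => / P y) y (rate b (n y) (/ P y) / mu (n y))).
  { intros z Hz Hz0. apply (flow_dZ _ _ _ _ _ _ F); [lra|assumption|].
    destruct (Hnear z Hz). lra. }
  assert (Hup : forall z, u <= z <= v -> 0 <= rate b (n z) (/ P z) ->
            / P z <= 3 * J ^ 2 / kappa0 + 1).
  { intros z Hz Hr0. destruct (Hnear z Hz) as [[Hn1 Hn2] HP].
    assert (HZ : 0 < / P z) by (apply Rinv_0_lt_compat; lra).
    assert (H4 := kappa0_le b (n z) ltac:(lra) Hn1).
    unfold rate in Hr0. set (Z := / P z) in *.
    assert (0 <= alpha * J * n z ^ 2 * Z).
    { apply Rmult_le_pos; [|lra]. apply Rmult_le_pos; [nra|apply pow2_ge_0]. }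
    assert (0 <= n z ^ 2) by apply pow2_ge_0.
    assert (kappa0 * Z ^ 2 <= 3 * J ^ 2).
    { assert (0 <= Z ^ 2) by apply pow2_ge_0. nra. }
    apply Rnot_lt_le. intros Hlt.
    set (q := 3 * J ^ 2 / kappa0) in *.
    assert (Hq : kappa0 * q = 3 * J ^ 2) by (unfold q; field; lra).
    assert (q < Z ^ 2) by nra. nra. }
  assert (Hlow : forall z, u <= z <= v -> rate b (n z) (/ P z) <= 0 ->
            J ^ 2 / (2 * c) <= / P z).
  { intros z Hz Hr0. destruct (Hnear z Hz) as [[Hn1 Hn2] HP].
    assert (HZ : 0 < / P z) by (apply Rinv_0_lt_compat; lra).
    unfold rate in Hr0. set (Z := / P z) in *. set (m := n z) in *.
    apply Rnot_lt_le. intros Hlt.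
    set (z1 := J ^ 2 / (2 * c)) in *.
    assert (Hq : 2 * (c * z1) = J ^ 2) by (unfold z1; field; lra).
    assert (z1 <= 1 / 2).
    { assert (J ^ 2 <= c); [unfold c; nra|]. nra. }
    assert (E1 : m ^ 2 <= (2 * J) ^ 2) by (apply pow_incr; lra).
    assert (E1' : m ^ 2 <= (3 * J / 2) ^ 2) by (apply pow_incr; lra).
    assert (E2 : m ^ 4 * (m - b) <= (2 * J) ^ 4 * (2 * J)).
    { apply Rmult_le_compat; [apply pow_le; lra|lra|apply pow_incr; lra|lra]. }
    assert (Z ^ 2 <= z1) by nra.
    assert (alpha * J * m ^ 2 * Z <= alpha * J * (2 * J) ^ 2 * z1).
    { apply Rmult_le_compat; [|lra| |lra].
      - apply Rmult_le_pos; [nra|apply pow2_ge_0].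
      - apply Rmult_le_compat_l; [nra|assumption]. }
    assert (m ^ 4 * (m - b) * Z ^ 2 <= (2 * J) ^ 4 * (2 * J) * z1).
    { apply Rmult_le_compat; [|apply pow2_ge_0|assumption|assumption].
      apply Rmult_le_pos; [apply pow_le; lra|lra]. }
    unfold c in Hq. nra. }
  destruct (flow_rate_0 _ _ _ _ _ _ F) as [HP0 HR0].
  split.
  - assert (- / P y <= - (J ^ 2 / (2 * c))); [|lra].
    apply (max_principle (fun y => - / P y)
      (fun y => - (rate b (n y) (/ P y) / mu (n y))) u v); [lra| | | | |assumption].
    + intros z Hz. apply (continuous_opp (V := R_NormedModule) (fun y => / P y)). now apply HcZ.
    + intros z Hz Hz0. apply (is_derive_opp (fun y => / P y)). now apply HdZ.
    + intros z Hz Hz0 Hs. apply Ropp_le_contravar, Hlow; [assumption|].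
      assert (Hmu := flow_mu_sign _ _ _ _ _ _ F z ltac:(lra) Hz0).
      assert (0 <= - rate b (n z) (/ P z)); [|lra].
      apply (mult_sign_transfer z (mu (n z))); [assumption|].
      unfold Rdiv in *. lra.
    + apply Ropp_le_contravar, Hlow; lra.
  - apply (max_principle (fun y => / P y)
      (fun y => rate b (n y) (/ P y) / mu (n y)) u v); [lra|assumption|assumption| | |assumption].
    + intros z Hz Hz0 Hs. apply Hup; [assumption|].
      assert (Hmu := flow_mu_sign _ _ _ _ _ _ F z ltac:(lra) Hz0).
      now apply (mult_sign_transfer z (mu (n z))).
    + apply Hup; lra.
Qed.

(** This is a bound on [Z' = rate / mu]. As that quotient is not known to be continuous at [0], the
    maximum principle is applied to [rate^2 - C^2 mu^2]. Along a solution,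
    [mu rate' = - K rate + mu Rn P]: a damped equation whose forcing carries the factor [mu]. *)
Lemma near_sonic_rate_bound : exists C,
  forall b A B n E P, flow b A B n E P ->
  forall u v, -A < u <= 0 -> 0 <= v < B -> near_sonic n P u v ->
  forall y, u <= y <= v -> Rabs (rate b (n y) (/ P y)) <= C * Rabs (mu (n y)).
Proof.
  destruct near_sonic_dxdn_bounds as [z1 [z2 [Hz1 [Hz2 HZ]]]].
  assert (Hk0 := kappa0_pos).
  assert (Hh : exists h, forall b m Z p, Rabs b <= J -> Rabs m <= 2 * J -> Rabs Z <= z2 ->
    Rabs p <= / z1 ->
    Rabs ((- 2 * m - 2 * alpha * J * m * Z - (5 * m ^ 4 - 4 * b * m ^ 3) * Z ^ 2) * p) <= h).
  { eexists. intros. bound_Rabs. }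
  destruct Hh as [h Hh].
  set (kap := 2 * kappa0 * z1).
  assert (Hkap : 0 < kap) by (unfold kap; nra).
  exists (h / kap).
  intros b A B n E P F u v Hu Hv Hnear y Hy.
  assert (Hb := flow_b _ _ _ _ _ _ F).
  set (Z := fun y => / P y).
  set (dZ := fun y => rate b (n y) (Z y) / mu (n y)).
  (* [Rn] and [- K] are the partial derivatives of [rate] in [n] and in [Z]. *)
  set (Rn := fun y => - 2 * n y - 2 * alpha * J * n y * Z y
                      - (5 * n y ^ 4 - 4 * b * n y ^ 3) * Z y ^ 2).
  set (K := fun y => alpha * J * n y ^ 2 + 2 * (n y ^ 4 * (n y - b)) * Z y).
  assert (HhR : forall y, u <= y <= v -> Rabs (Rn y * P y) <= h /\ kap <= K y).
  { intros z Hz. destruct (Hnear z Hz) as [[Hn1 Hn2] HP].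
    assert (HZz := HZ _ _ _ _ _ _ F u v Hu Hv Hnear z Hz).
    split.
    - apply Hh.
      + rewrite Rabs_pos_eq; lra.
      + rewrite Rabs_pos_eq; lra.
      + unfold Z. rewrite Rabs_pos_eq; lra.
      + rewrite Rabs_pos_eq by lra. rewrite <- (Rinv_inv (P z)).
        apply Rinv_le_contravar; lra.
    - unfold K, kap. assert (H4 := kappa0_le b (n z) ltac:(lra) Hn1).
      fold (Z z) in HZz.
      assert (0 <= alpha * J * n z ^ 2) by (apply Rmult_le_pos; [nra|apply pow2_ge_0]).
      assert (kappa0 * z1 <= n z ^ 4 * (n z - b) * Z z) by (apply Rmult_le_compat; lra).
      lra. }
  assert (Hh0 : 0 <= h / kap).
  { destruct (HhR 0 ltac:(lra)) as [H _].
    apply Rmult_le_pos; [|left; now apply Rinv_0_lt_compat].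
    assert (H0 := Rabs_pos (Rn 0 * P 0)). lra. }
  assert (HcZ : forall y, u <= y <= v -> continuous Z y).
  { intros z Hz. apply continuous_Rinv_comp; [exact (flow_P _ _ _ _ _ _ F z)|].
    destruct (Hnear z Hz). lra. }
  assert (HdZ : forall y, u <= y <= v -> y <> 0 -> is_derive Z y (dZ y)).
  { intros z Hz Hz0. apply (flow_dZ _ _ _ _ _ _ F); [lra|assumption|].
    destruct (Hnear z Hz). lra. }
  assert (Hcn := cont_n _ _ _ _ _ _ F).
  apply pow2_le_Rabs; [apply Rmult_le_pos; [assumption|apply Rabs_pos]|].
  rewrite Rpow_mult_distr, pow2_abs.
  set (C2 := (h / kap) ^ 2).
  assert (HC2 : 0 <= C2) by apply pow2_ge_0.
  assert (rate b (n y) (Z y) ^ 2 - C2 * mu (n y) ^ 2 <= 0); [|unfold Z in *; lra].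
  apply (max_principle (fun y => rate b (n y) (Z y) ^ 2 - C2 * mu (n y) ^ 2)
    (fun y => 2 * rate b (n y) (Z y) * (Rn y * P y - K y * dZ y)
              - C2 * (2 * mu (n y) * ((3 * n y ^ 2 - J ^ 2) * P y))) u v);
    [lra| | | | |assumption].
  - intros z Hz.
    unfold rate, mu. prove_continuous; first [apply Hcn|now apply HcZ].
  - intros z Hz Hz0.
    assert (HD1 := flow_n _ _ _ _ _ _ F z). assert (HD2 := HdZ z Hz Hz0).
    unfold rate at 1, mu at 1. derive_hyps. auto_derive; [split_conj|].
    rewrite_derive. unfold Rn, K, rate, mu. ring.
  - intros z Hz Hz0 Hs.
    assert (Hmu := flow_mu_sign _ _ _ _ _ _ F z ltac:(lra) Hz0).
    destruct (Hnear z Hz) as [[Hn1 Hn2] HP]. destruct (HhR z Hz) as [Hh1 HK].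
    set (sig := rate b (n z) (Z z)) in *. set (m := mu (n z)) in *.
    assert (Hm0 : m <> 0) by (intros H0; rewrite H0 in Hmu; lra).
    assert (Hq : 0 <= sig * (- K z * sig + m * (Rn z * P z))).
    { apply (mult_sign_transfer z m); [assumption|].
      (* [mu^2] grows away from [0], so subtracting it only lowers the outward derivative. What
         remains is the sign condition for [rate] alone. *)
      assert (0 <= C2 * (z * m) * ((3 * n z ^ 2 - J ^ 2) * P z)).
      { apply Rmult_le_pos; [apply Rmult_le_pos; lra|].
        apply Rmult_le_pos; [|lra]. assert ((3 * J / 4) ^ 2 <= n z ^ 2) by (apply pow_incr; lra).
        assert (0 <= J ^ 2) by apply pow2_ge_0. lra. }
      replace (z * (sig * (- K z * sig + m * (Rn z * P z)) / m))
        with (z * (sig * (Rn z * P z - K z * dZ z))).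
      - lra.
      - unfold dZ. fold sig. fold m. field. assumption. }
    assert (Rabs sig <= h / kap * Rabs m).
    { apply (damping_bound _ (K z) (m * (Rn z * P z)) kap); [lra| |assumption].
      rewrite Rabs_mult. replace (kap * (h / kap * Rabs m)) with (Rabs m * h) by (field; lra).
      apply Rmult_le_compat_l; [apply Rabs_pos|assumption]. }
    assert (sig ^ 2 <= (h / kap * Rabs m) ^ 2).
    { now apply pow_maj_Rabs. }
    rewrite Rpow_mult_distr, pow2_abs in H0. fold C2 in H0. lra.
  - destruct (flow_rate_0 _ _ _ _ _ _ F) as [HP0 HR0]. unfold Z. rewrite HR0.
    assert (0 <= C2 * mu (n 0) ^ 2) by (apply Rmult_le_pos; [assumption|apply pow2_ge_0]).
    lra.
Qed.

(** The threshold exceeds [k], so [flow_increasing_above] makes [n] monotone from [y] to [0]. One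
    value in the band then controls the whole segment. *)
Lemma near_sonic_left b A B n E P : flow b A B n E P ->
  forall y, -A < y <= 0 -> (J + k) / 2 <= n y -> near_sonic n P y 0.
Proof.
  intros F y Hy Hn z Hz.
  assert (HB := flow_B _ _ _ _ _ _ F).
  assert (Hn0 := flow_sonic _ _ _ _ _ _ F).
  assert (HP : forall t, y <= t <= 0 -> 0 < P t).
  { intros t Ht. destruct (Req_dec t 0) as [->|].
    - now destruct (flow_rate_0 _ _ _ _ _ _ F).
    - apply (flow_increasing_above _ _ _ _ _ _ F y); lra. }
  split; [|now apply HP].
  assert (n y <= n z) by (apply (flow_increasing _ _ _ _ _ _ F); [lra|intros; apply HP; lra]).
  assert (n z <= n 0) by (apply (flow_increasing _ _ _ _ _ _ F); [lra|intros; apply HP; lra]).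
  lra.
Qed.

Lemma near_sonic_right b A B n E P : flow b A B n E P ->
  forall y, 0 <= y < B -> n y <= 3 * J / 2 -> near_sonic n P 0 y.
Proof.
  intros F y Hy Hn z Hz.
  assert (HA := flow_A _ _ _ _ _ _ F).
  assert (Hn0 := flow_sonic _ _ _ _ _ _ F).
  assert (HP : forall t, 0 <= t <= y -> 0 < P t).
  { intros t Ht. destruct (Req_dec t 0) as [->|].
    - now destruct (flow_rate_0 _ _ _ _ _ _ F).
    - apply (flow_P_sub _ _ _ _ _ _ F); lra. }
  split; [|now apply HP].
  assert (n 0 <= n z) by (apply (flow_increasing _ _ _ _ _ _ F); [lra|intros; apply HP; lra]).
  assert (n z <= n y) by (apply (flow_increasing _ _ _ _ _ _ F); [lra|intros; apply HP; lra]).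
  lra.
Qed.

Lemma near_sonic_union n P u v :
  near_sonic n P u 0 -> near_sonic n P 0 v -> near_sonic n P u v.
Proof. intros H1 H2 y Hy. destruct (Rle_lt_dec y 0); [apply H1|apply H2]; lra. Qed.

(** A continuation argument: in the band the slope is at most [1 / z1], so over a length [y0] the
    density moves by at most [(J - k) / 4]. The edges of the band are at distances [(J - k) / 2] and
    [J / 2] from [J], hence cannot be reached. *)
Lemma near_sonic_window : exists y0, 0 < y0 /\
  forall b A B n E P, flow b A B n E P ->
  forall u v, -A < u <= 0 -> 0 <= v < B -> -y0 <= u -> v <= y0 -> near_sonic n P u v.
Proof.
  destruct near_sonic_dxdn_bounds as [z1 [z2 [Hz1 [Hz2 HZ]]]].
  exists (z1 * ((J - k) / 4)). split; [apply Rmult_lt_0_compat; lra|].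
  intros b A B n E P F u v Hu Hv Hu0 Hv0.
  assert (HA := flow_A _ _ _ _ _ _ F). assert (HB := flow_B _ _ _ _ _ _ F).
  assert (Hn0 := flow_sonic _ _ _ _ _ _ F).
  assert (Hcn := cont_n _ _ _ _ _ _ F).
  assert (Hslope : forall a c, -A < a <= 0 -> 0 <= c < B -> near_sonic n P a c -> a < c ->
            n c - n a <= (c - a) / z1).
  { intros a c Ha Hc Hnear Hac.
    destruct (mean_value n P a c) as [x [Hx He]]; [lra|intros; apply Hcn| |].
    { intros x Hx. exact (flow_n _ _ _ _ _ _ F x). }
    destruct (HZ _ _ _ _ _ _ F a c Ha Hc Hnear x ltac:(lra)) as [H1 _].
    destruct (Hnear x ltac:(lra)) as [_ HP].
    assert (P x <= / z1).
    { rewrite <- (Rinv_inv (P x)). apply Rinv_le_contravar; lra. }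
    rewrite He. unfold Rdiv. rewrite (Rmult_comm (c - a)).
    apply Rmult_le_compat_r; lra. }
  assert (Hq : z1 * ((J - k) / 4) / z1 = (J - k) / 4) by (field; lra).
  assert (Hi : 0 < / z1) by (apply Rinv_0_lt_compat; lra).
  apply near_sonic_union.
  - apply (near_sonic_left _ _ _ _ _ _ F); [assumption|].
    apply Rnot_lt_le. intros Hlt.
    destruct (ivt n u 0 ((J + k) / 2)) as [t [Ht Hnt]]; [assumption|lra|lra|].
    assert (Hne : t <> 0) by (intros ->; lra).
    assert (n 0 - n t <= (0 - t) / z1).
    { apply Hslope; [lra|lra| |lra].
      apply (near_sonic_left _ _ _ _ _ _ F); lra. }
    assert ((0 - t) / z1 <= z1 * ((J - k) / 4) / z1).
    { apply Rmult_le_compat_r; lra. }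
    lra.
  - apply (near_sonic_right _ _ _ _ _ _ F); [assumption|].
    apply Rnot_lt_le. intros Hlt.
    destruct (ivt n 0 v (3 * J / 2)) as [t [Ht Hnt]]; [assumption|lra|lra|].
    assert (Hne : t <> 0) by (intros ->; lra).
    assert (n t - n 0 <= (t - 0) / z1).
    { apply Hslope; [lra|lra| |lra].
      apply (near_sonic_right _ _ _ _ _ _ F); lra. }
    assert ((t - 0) / z1 <= z1 * ((J - k) / 4) / z1).
    { apply Rmult_le_compat_r; lra. }
    lra.
Qed.

(** Either [n y] is outside the band, at distance at least [(J - k) / 2] from [J], or a slope of at
    least [1 / z2] over a length of at least [y0] has moved [n] by [y0 / z2]. *)
Lemma far_from_sonic (y0 : R) : 0 < y0 -> exists eta, 0 < eta /\
  forall b A B n E P, flow b A B n E P ->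
  forall y, -A < y < B -> y0 <= Rabs y -> eta <= Rabs (n y ^ 2 - J ^ 2).
Proof.
  intros Hy0.
  destruct near_sonic_dxdn_bounds as [z1 [z2 [Hz1 [Hz2 HZ]]]].
  set (d := Rmin (y0 / z2) ((J - k) / 2)).
  assert (Hd : 0 < d) by (apply Rmin_glb_lt; [apply Rdiv_lt_0_compat|]; lra).
  assert (Hd1 : d <= y0 / z2) by apply Rmin_l.
  assert (Hd2 : d <= (J - k) / 2) by apply Rmin_r.
  exists (J * d). split; [nra|].
  intros b A B n E P F y Hy Hay.
  assert (HA := flow_A _ _ _ _ _ _ F). assert (HB := flow_B _ _ _ _ _ _ F).
  assert (Hn0 := flow_sonic _ _ _ _ _ _ F).
  assert (Hcn := cont_n _ _ _ _ _ _ F).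
  assert (Hslope : forall a c, -A < a <= 0 -> 0 <= c < B -> near_sonic n P a c -> y0 <= c - a ->
            d <= n c - n a).
  { intros a c Ha Hc Hnear Hac.
    destruct (mean_value n P a c) as [x [Hx He]]; [lra|intros; apply Hcn| |].
    { intros x Hx. exact (flow_n _ _ _ _ _ _ F x). }
    destruct (HZ _ _ _ _ _ _ F a c Ha Hc Hnear x ltac:(lra)) as [_ H1].
    destruct (Hnear x ltac:(lra)) as [_ HP].
    assert (/ z2 <= P x).
    { rewrite <- (Rinv_inv (P x)). apply Rinv_le_contravar; [|lra].
      now apply Rinv_0_lt_compat. }
    assert (0 < / z2) by (apply Rinv_0_lt_compat; lra).
    assert (y0 / z2 <= P x * (c - a)); [|lra].
    unfold Rdiv. rewrite Rmult_comm. apply Rmult_le_compat; lra. }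
  assert (Hp := flow_pos _ _ _ _ _ _ F y ltac:(lra)).
  assert (Hor : n y <= J - d \/ J + d <= n y).
  { destruct (Rle_lt_dec y 0).
    - rewrite Rabs_left1 in Hay by lra. left.
      destruct (Rle_lt_dec ((J + k) / 2) (n y)); [|lra].
      assert (d <= n 0 - n y); [|lra]. apply Hslope; [lra|lra| |lra].
      apply (near_sonic_left _ _ _ _ _ _ F); lra.
    - rewrite Rabs_pos_eq in Hay by lra. right.
      destruct (Rle_lt_dec (n y) (3 * J / 2)); [|lra].
      assert (d <= n y - n 0); [|lra]. apply Hslope; [lra|lra| |lra].
      apply (near_sonic_right _ _ _ _ _ _ F); lra. }
  replace (n y ^ 2 - J ^ 2) with ((n y + J) * (n y - J)) by ring.
  rewrite Rabs_mult. apply Rmult_le_compat; [lra|lra| |].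
  - rewrite Rabs_pos_eq; lra.
  - destruct Hor; [rewrite Rabs_left1|rewrite Rabs_pos_eq]; lra.
Qed.

(** Inside the window [P >= 1 / z2]. Beyond it [E - alpha >= (J - k) y0] keeps the numerator of
    [flow_P_eq] away from zero, while the denominator is at most [r^2]. *)
Lemma flow_P_lower : exists c, 0 < c /\
  forall b A B n E P, flow b A B n E P -> forall y, 0 <= y < B -> c <= P y.
Proof.
  destruct near_sonic_dxdn_bounds as [z1 [z2 [Hz1 [Hz2 HZ]]]].
  destruct near_sonic_window as [y0 [Hy0 HW]].
  set (q := J * ((J - k) * y0) * J ^ 2 / r ^ 2).
  assert (HJ2 : 0 < J ^ 2) by (apply pow_lt; lra).
  assert (Hr2 : 0 < r ^ 2) by (apply pow_lt; lra).
  assert (Hq : 0 < q).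
  { apply Rdiv_lt_0_compat; [|assumption]. repeat apply Rmult_lt_0_compat; lra. }
  exists (Rmin (/ z2) q). split.
  { apply Rmin_glb_lt; [now apply Rinv_0_lt_compat|assumption]. }
  intros b A B n E P F y Hy.
  assert (HA := flow_A _ _ _ _ _ _ F). assert (HB := flow_B _ _ _ _ _ _ F).
  destruct (Rle_lt_dec y y0).
  - apply Rle_trans with (/ z2); [apply Rmin_l|].
    assert (Hnear : near_sonic n P 0 y) by (apply (HW _ _ _ _ _ _ F); lra).
    destruct (HZ _ _ _ _ _ _ F 0 y ltac:(lra) Hy Hnear y ltac:(lra)) as [_ H1].
    destruct (Hnear y ltac:(lra)) as [_ HP].
    rewrite <- (Rinv_inv (P y)). apply Rinv_le_contravar; [|lra].
    now apply Rinv_0_lt_compat.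
  - apply Rle_trans with q; [apply Rmin_r|].
    rewrite (flow_P_eq _ _ _ _ _ _ F y) by lra.
    assert (Hn := flow_sub _ _ _ _ _ _ F y ltac:(lra)).
    assert (HE := flow_E_sub _ _ _ _ _ _ F y ltac:(lra)).
    assert (Hnr := flow_n_le _ _ _ _ _ _ F y ltac:(lra)).
    assert (J ^ 2 <= n y ^ 2) by (apply pow_incr; lra).
    assert (n y ^ 2 <= r ^ 2) by (apply pow_incr; lra).
    assert ((J - k) * y0 <= (J - k) * y) by (apply Rmult_le_compat_l; lra).
    assert (0 < (J - k) * y0) by (apply Rmult_lt_0_compat; lra).
    assert (J * ((J - k) * y0) <= n y * E y - alpha * J).
    { assert (J * ((J - k) * y0) <= n y * (E y - alpha)) by (apply Rmult_le_compat; lra).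
      assert (0 <= (n y - J) * alpha) by (apply Rmult_le_pos; lra). lra. }
    assert (0 < n y ^ 2 - J ^ 2) by nra.
    unfold q, Rdiv. apply Rmult_le_compat.
    + left. apply Rmult_lt_0_compat; [|assumption]. apply Rmult_lt_0_compat; lra.
    + left. now apply Rinv_0_lt_compat.
    + apply Rmult_le_compat; try lra. apply Rmult_le_pos; lra.
    + apply Rinv_le_contravar; lra.
Qed.

Lemma flow_bounds b A B n E P : flow b A B n E P -> forall y, -A <= y <= B ->
  Rabs (n y) <= r /\ Rabs (E y) <= alpha + (r + k) * L /\ Rabs b <= k.
Proof.
  intros F y Hy. split; [|split].
  - rewrite Rabs_pos_eq; [now apply (flow_n_le _ _ _ _ _ _ F)|].
    left. now apply (flow_pos _ _ _ _ _ _ F).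
  - now apply (flow_E_bound _ _ _ _ _ _ F).
  - assert (Hb := flow_b _ _ _ _ _ _ F). rewrite Rabs_pos_eq; lra.
Qed.

(** Beyond the window the explicit formulas have denominators bounded below. Inside it
    [P' = - Z' P^2], with [Z'] bounded by [near_sonic_rate_bound]. *)
Lemma flow_P_lipschitz : exists C,
  forall b A B n E P, flow b A B n E P ->
  (forall y, -A < y < B -> Rabs (P y) <= C) /\
  (forall y, -A < y < B -> y <> 0 -> Rabs (dP b (n y) (E y) (P y)) <= C).
Proof.
  destruct near_sonic_dxdn_bounds as [z1 [z2 [Hz1 [Hz2 HZ]]]].
  destruct near_sonic_window as [y0 [Hy0 HW]].
  destruct near_sonic_rate_bound as [C1 HC1].
  destruct (far_from_sonic y0 Hy0) as [eta [Heta Hfar]].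
  assert (HQ : exists C, forall m e i, Rabs m <= r -> Rabs e <= alpha + (r + k) * L -> Rabs i <= / eta ->
    Rabs ((m * e - alpha * J) * m ^ 2 * i) <= C).
  { eexists. intros. bound_Rabs. }
  destruct HQ as [C2 HC2].
  assert (HQ : exists C, forall b m e i p,
    Rabs b <= k -> Rabs m <= r -> Rabs e <= alpha + (r + k) * L -> Rabs i <= / eta -> Rabs p <= C2 ->
    Rabs ((2 * m * p * (m * e - alpha * J) + m ^ 2 * (p * e + m * (m - b))) * i
          - (m * e - alpha * J) * m ^ 2 * (2 * m * p) * i ^ 2) <= C).
  { eexists. intros. bound_Rabs. }
  destruct HQ as [C3 HC3].
  exists (Rmax (Rmax C2 (/ z1)) (Rmax C3 (Rabs C1 * (/ z1) ^ 2))).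
  intros b A B n E P F.
  assert (HA := flow_A _ _ _ _ _ _ F). assert (HB := flow_B _ _ _ _ _ _ F).
  assert (Hmain : forall y, -A < y < B ->
    (Rabs (P y) <= C2 \/ Rabs (P y) <= / z1) /\
    (y <> 0 -> Rabs (dP b (n y) (E y) (P y)) <= C3 \/
               Rabs (dP b (n y) (E y) (P y)) <= Rabs C1 * (/ z1) ^ 2)).
  { intros y Hy.
    destruct (flow_bounds _ _ _ _ _ _ F y ltac:(lra)) as [B1 [B2 B3]].
    destruct (Rle_lt_dec y0 (Rabs y)) as [Hf|Hn].
    - assert (Hy00 : y <> 0) by (intros ->; rewrite Rabs_R0 in Hf; lra).
      assert (Hi := Rabs_inv_le _ _ Heta (Hfar _ _ _ _ _ _ F y Hy Hf)).
      assert (HPb : Rabs (P y) <= C2).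
      { rewrite (flow_P_eq _ _ _ _ _ _ F y) by lra. now apply HC2. }
      split; [now left|]. intros _. left.
      unfold dP, Rdiv. rewrite <- pow_inv. now apply HC3.
    - set (u := Rmin y 0). set (v := Rmax y 0).
      assert (Huv : -A < u <= 0 /\ 0 <= v < B /\ -y0 <= u /\ v <= y0 /\ u <= y <= v).
      { apply Rabs_def2 in Hn. unfold u, v.
        destruct (Rle_lt_dec y 0); [rewrite Rmin_left, Rmax_right|rewrite Rmin_right, Rmax_left]; lra. }
      destruct Huv as [Hu [Hv [Hu0 [Hv0 Hyuv]]]].
      assert (Hnear := HW _ _ _ _ _ _ F u v Hu Hv Hu0 Hv0).
      assert (HZy := HZ _ _ _ _ _ _ F u v Hu Hv Hnear y Hyuv).
      assert (HRy := HC1 _ _ _ _ _ _ F u v Hu Hv Hnear y Hyuv).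
      destruct (Hnear y Hyuv) as [_ HP].
      assert (HPb : Rabs (P y) <= / z1).
      { rewrite Rabs_pos_eq by lra. rewrite <- (Rinv_inv (P y)). apply Rinv_le_contravar; lra. }
      split; [now right|]. intros Hy00. right.
      assert (Hmu := flow_mu_sign _ _ _ _ _ _ F y ltac:(lra) Hy00).
      assert (Hm0 : mu (n y) <> 0) by (intros H0; rewrite H0 in Hmu; lra).
      assert (HdZ := flow_dZ _ _ _ _ _ _ F y Hy Hy00 ltac:(lra)).
      assert (HdP := flow_dP _ _ _ _ _ _ F y Hy Hy00).
      assert (Heq : dP b (n y) (E y) (P y) = - (rate b (n y) (/ P y) / mu (n y)) * P y ^ 2).
      { assert (H1 := is_derive_inv P y _ HdP (Rgt_not_eq _ _ HP)).
        apply is_derive_unique in HdZ. apply is_derive_unique in H1.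
        rewrite (eq_trans (eq_sym HdZ) H1). field. lra. }
      rewrite Heq. apply Rabs_mult_le; [|now apply Rabs_pow_le].
      rewrite Rabs_Ropp. unfold Rdiv. rewrite Rabs_mult, Rabs_inv.
      assert (0 < Rabs (mu (n y))) by now apply Rabs_pos_lt.
      apply (Rmult_le_reg_r (Rabs (mu (n y)))); [assumption|].
      rewrite Rmult_assoc, Rinv_l, Rmult_1_r by lra.
      apply Rle_trans with (C1 * Rabs (mu (n y))); [assumption|].
      apply Rmult_le_compat_r; [lra|apply Rle_abs]. }
  assert (M1 := Rmax_l (Rmax C2 (/ z1)) (Rmax C3 (Rabs C1 * (/ z1) ^ 2))).
  assert (M2 := Rmax_r (Rmax C2 (/ z1)) (Rmax C3 (Rabs C1 * (/ z1) ^ 2))).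
  assert (M3 := Rmax_l C2 (/ z1)). assert (M4 := Rmax_r C2 (/ z1)).
  assert (M5 := Rmax_l C3 (Rabs C1 * (/ z1) ^ 2)). assert (M6 := Rmax_r C3 (Rabs C1 * (/ z1) ^ 2)).
  split.
  - intros y Hy. destruct (Hmain y Hy) as [[H|H] _]; lra.
  - intros y Hy Hy00. destruct (Hmain y Hy) as [_ H]. destruct (H Hy00); lra.
Qed.

(* Junk value: at the sonic point [rate / mu] is [0 / 0 = 0]. *)
Lemma flow_mu_quotient b A B n E P : flow b A B n E P -> forall y, -A <= y <= B ->
  mu (n y) * (rate b (n y) (/ P y) / mu (n y)) = rate b (n y) (/ P y).
Proof.
  intros F y Hy. destruct (Req_dec y 0) as [->|Hy0].
  - destruct (flow_rate_0 _ _ _ _ _ _ F) as [_ H]. rewrite H. unfold Rdiv. ring.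
  - assert (Hmu := flow_mu_sign _ _ _ _ _ _ F y Hy Hy0).
    field. intros H0; rewrite H0 in Hmu; lra.
Qed.

(** * Comparison of two solutions *)

(** Two evaluation points let the same predicate express comparison at one translated point,
    Lipschitz continuity of one solution, and comparison at one original point under two
    translations. *)
Definition close (K beta : R) (n1 E1 P1 n2 E2 P2 : R -> R) (y1 y2 : R) :=
  Rabs (n1 y1 - n2 y2) <= K * beta /\ Rabs (E1 y1 - E2 y2) <= K * beta /\
  Rabs (P1 y1 - P2 y2) <= K * beta.

(** The difference [V] of the two [Z] obeys a damped equation forced by [n1 - n2] and [b1 - b2]. As
    [n1] and [n2] agree at [0], [n1 - n2] is at most a multiple of [y0 max |V|], which a short
    window absorbs into the left-hand side. *)
Lemma flows_close_near : exists y0 C, 0 < y0 /\ 0 < C /\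
  forall b1 A1 B1 n1 E1 P1 b2 A2 B2 n2 E2 P2,
  flow b1 A1 B1 n1 E1 P1 -> flow b2 A2 B2 n2 E2 P2 ->
  forall y, -A1 < y < B1 -> -A2 < y < B2 -> Rabs y <= y0 ->
  close C (Rabs (b1 - b2)) n1 E1 P1 n2 E2 P2 y y.
Proof.
  destruct near_sonic_dxdn_bounds as [z1 [z2 [Hz1 [Hz2 HZ]]]].
  destruct near_sonic_window as [y1 [Hy1 HW]].
  destruct near_sonic_rate_bound as [C1 HC1].
  assert (Hk0 := kappa0_pos).
  assert (Hi1 : 0 < / z1) by now apply Rinv_0_lt_compat.
  assert (HQ : exists C, forall m1 m2 b1 Z W,
    Rabs m1 <= r -> Rabs m2 <= r -> Rabs b1 <= k -> Rabs Z <= z2 -> Rabs W <= Rabs C1 ->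
    Rabs (- (m1 + m2) * (1 + alpha * J * Z)
          - Z ^ 2 * (m1 ^ 4 + m1 ^ 3 * m2 + m1 ^ 2 * m2 ^ 2 + m1 * m2 ^ 3 + m2 ^ 4
                     - b1 * ((m1 + m2) * (m1 ^ 2 + m2 ^ 2)))
          - (m1 ^ 2 + m1 * m2 + m2 ^ 2 - J ^ 2) * W) <= C).
  { eexists. intros. bound_Rabs. }
  destruct HQ as [q Hq].
  assert (HQ : exists C, forall m2 Z,
    Rabs m2 <= r -> Rabs Z <= z2 -> Rabs (m2 ^ 4 * Z ^ 2) <= C).
  { eexists. intros. bound_Rabs. }
  destruct HQ as [q' Hq'].
  set (kap := 2 * kappa0 * z1).
  assert (Hkap : 0 < kap) by (unfold kap; nra).
  assert (Hq0 : 0 <= q).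
  { eapply Rle_trans; [apply Rabs_pos|apply (Hq 0 0 0 0 0); rewrite Rabs_R0; try lra; apply Rabs_pos]. }
  assert (Hq'0 : 0 <= q').
  { eapply Rle_trans; [apply Rabs_pos|apply (Hq' 0 0); rewrite Rabs_R0; lra]. }
  (* The last entry makes the contribution of [n1 - n2] to the bound on [V] at most half of
     [max |V|]. *)
  set (y0 := Rmin y1 (Rmin 1 (kap * z1 ^ 2 / (2 * (q + 1))))).
  assert (Hz12 : 0 < z1 ^ 2) by (apply pow_lt; lra).
  assert (Hy2 : 0 < kap * z1 ^ 2 / (2 * (q + 1))).
  { apply Rdiv_lt_0_compat; [apply Rmult_lt_0_compat|]; lra. }
  assert (Hy0 : 0 < y0) by (repeat apply Rmin_glb_lt; lra).
  assert (Hy01 : y0 <= y1) by apply Rmin_l.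
  assert (Hy02 : y0 <= 1) by (eapply Rle_trans; [apply Rmin_r|apply Rmin_l]).
  assert (Hy03 : y0 <= kap * z1 ^ 2 / (2 * (q + 1))) by (eapply Rle_trans; [apply Rmin_r|apply Rmin_r]).
  set (cV := 2 * q' / kap).
  assert (HcV : 0 <= cV).
  { apply Rmult_le_pos; [lra|]. left; now apply Rinv_0_lt_compat. }
  set (cP := cV * (/ z1) ^ 2).
  assert (HcP : 0 <= cP) by (apply Rmult_le_pos; [lra|apply pow2_ge_0]).
  exists y0, (cP + 1). split; [assumption|]. split; [lra|].
  intros b1 A1 B1 n1 E1 P1 b2 A2 B2 n2 E2 P2 F1 F2 y HyA HyB Hyy.
  assert (HA1 := flow_A _ _ _ _ _ _ F1). assert (HB1 := flow_B _ _ _ _ _ _ F1).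
  assert (HA2 := flow_A _ _ _ _ _ _ F2). assert (HB2 := flow_B _ _ _ _ _ _ F2).
  assert (Hb1 := flow_b _ _ _ _ _ _ F1). assert (Hb2 := flow_b _ _ _ _ _ _ F2).
  assert (Hcn1 := cont_n _ _ _ _ _ _ F1). assert (Hcn2 := cont_n _ _ _ _ _ _ F2).
  assert (HcP1 := flow_P _ _ _ _ _ _ F1). assert (HcP2 := flow_P _ _ _ _ _ _ F2).
  set (beta := Rabs (b1 - b2)).
  assert (Hbeta : 0 <= beta) by apply Rabs_pos.
  set (u := Rmin y 0). set (v := Rmax y 0).
  assert (Huv : (-A1 < u <= 0 /\ 0 <= v < B1) /\ (-A2 < u <= 0 /\ 0 <= v < B2) /\
                -y0 <= u /\ v <= y0 /\ u <= y <= v).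
  { apply Rabs_le_between in Hyy. unfold u, v.
    destruct (Rle_lt_dec y 0); [rewrite Rmin_left, Rmax_right|rewrite Rmin_right, Rmax_left]; lra. }
  destruct Huv as [[Hu1 Hv1] [[Hu2 Hv2] [Hu0 [Hv0 Hyuv]]]].
  assert (Hnear1 := HW _ _ _ _ _ _ F1 u v Hu1 Hv1 ltac:(lra) ltac:(lra)).
  assert (Hnear2 := HW _ _ _ _ _ _ F2 u v Hu2 Hv2 ltac:(lra) ltac:(lra)).
  assert (HZ1 := HZ _ _ _ _ _ _ F1 u v Hu1 Hv1 Hnear1).
  assert (HZ2 := HZ _ _ _ _ _ _ F2 u v Hu2 Hv2 Hnear2).
  set (Z1 := fun y => / P1 y) in *. set (Z2 := fun y => / P2 y) in *.
  set (W1 := fun y => rate b1 (n1 y) (Z1 y) / mu (n1 y)).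
  set (W2 := fun y => rate b2 (n2 y) (Z2 y) / mu (n2 y)).
  assert (HW2 : forall z, u <= z <= v -> Rabs (W2 z) <= Rabs C1).
  { intros z Hz. unfold W2, Rdiv. rewrite Rabs_mult, Rabs_inv.
    destruct (Req_dec z 0) as [->|Hz0].
    - destruct (flow_rate_0 _ _ _ _ _ _ F2) as [_ H]. unfold Z2. rewrite H, Rabs_R0, Rmult_0_l.
      apply Rabs_pos.
    - assert (Hmu := flow_mu_sign _ _ _ _ _ _ F2 z ltac:(lra) Hz0).
      assert (Hm0 : mu (n2 z) <> 0) by (intros H0; rewrite H0 in Hmu; lra).
      assert (0 < Rabs (mu (n2 z))) by now apply Rabs_pos_lt.
      apply (Rmult_le_reg_r (Rabs (mu (n2 z)))); [assumption|].
      rewrite Rmult_assoc, Rinv_l, Rmult_1_r by lra.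
      apply Rle_trans with (C1 * Rabs (mu (n2 z))).
      + exact (HC1 _ _ _ _ _ _ F2 u v Hu2 Hv2 Hnear2 z Hz).
      + apply Rmult_le_compat_r; [lra|apply Rle_abs]. }
  set (V := fun y => Z1 y - Z2 y).
  assert (HcZ1 : forall z, u <= z <= v -> continuous Z1 z).
  { intros z Hz. apply continuous_Rinv_comp; [apply HcP1|]. destruct (Hnear1 z Hz); lra. }
  assert (HcZ2 : forall z, u <= z <= v -> continuous Z2 z).
  { intros z Hz. apply continuous_Rinv_comp; [apply HcP2|]. destruct (Hnear2 z Hz); lra. }
  assert (HcontV : forall z, u <= z <= v -> continuous V z).
  { intros z Hz. apply (continuous_minus (V := R_NormedModule)); [now apply HcZ1|now apply HcZ2]. }
  destruct (continuous_max_on (fun z => Rabs (V z)) u v) as [t [Ht Hmax]]; [lra| |].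
  { intros z Hz. apply (continuous_comp V Rabs); [now apply HcontV|apply continuous_Rabs]. }
  set (M := Rabs (V t)) in *.
  assert (HPV : forall z, u <= z <= v -> Rabs (P1 z - P2 z) <= M * (/ z1) ^ 2).
  { intros z Hz. destruct (Hnear1 z Hz) as [_ Hp1]. destruct (Hnear2 z Hz) as [_ Hp2].
    assert (Q1 := HZ1 z Hz). assert (Q2 := HZ2 z Hz). unfold Z1 in Q1. unfold Z2 in Q2.
    replace (P1 z - P2 z) with (- V z * (P1 z * P2 z)) by (unfold V, Z1, Z2; field; lra).
    apply Rabs_mult_le; [rewrite Rabs_Ropp; now apply Hmax|].
    replace ((/ z1) ^ 2) with (/ z1 * / z1) by ring.
    apply Rabs_mult_le; rewrite Rabs_pos_eq by lra.
    - rewrite <- (Rinv_inv (P1 z)). apply Rinv_le_contravar; lra.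
    - rewrite <- (Rinv_inv (P2 z)). apply Rinv_le_contravar; lra. }
  assert (HM : 0 <= M) by apply Rabs_pos.
  assert (from_0 : forall (f df : R -> R) (K : R), 0 <= K -> (forall z, is_derive f z (df z)) ->
            (forall z, u <= z <= v -> Rabs (df z) <= K) ->
            forall z, u <= z <= v -> Rabs (f z - f 0) <= K * y0).
  { intros f df K HK Hf HKf z Hz.
    assert (Hcf : forall x, continuous f x).
    { intros x. apply (ex_derive_continuous (V := R_NormedModule)). now exists (df x). }
    destruct (Rle_lt_dec z 0).
    - rewrite Rabs_minus_sym. apply Rle_trans with (K * (0 - z)); [|apply Rmult_le_compat_l; lra].
      apply lipschitz_of_derive with df; intros; auto; try apply HKf; lra.
    - apply Rle_trans with (K * (z - 0)); [|apply Rmult_le_compat_l; lra].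
      apply lipschitz_of_derive with df; intros; auto; try apply HKf; lra. }
  assert (HN : forall z, u <= z <= v -> Rabs (n1 z - n2 z) <= M * (/ z1) ^ 2 * y0).
  { intros z Hz.
    replace (n1 z - n2 z) with ((n1 z - n2 z) - (n1 0 - n2 0)).
    2: { rewrite (flow_sonic _ _ _ _ _ _ F1), (flow_sonic _ _ _ _ _ _ F2). ring. }
    apply (from_0 (fun z => n1 z - n2 z) (fun z => P1 z - P2 z)); [|intros x|exact HPV|assumption].
    - apply Rmult_le_pos; [assumption|apply pow2_ge_0].
    - apply (is_derive_minus n1 n2); [apply (flow_n _ _ _ _ _ _ F1)|apply (flow_n _ _ _ _ _ _ F2)]. }
  set (M' := (q * (M * (/ z1) ^ 2 * y0) + q' * beta) / kap).
  assert (HV : forall z, u <= z <= v -> Rabs (V z) <= M').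
  { apply (damped_bound V (fun z => W1 z - W2 z)
      (fun z => alpha * J * n1 z ^ 2 + (n1 z ^ 4 * (n1 z - b1)) * (Z1 z + Z2 z))
      (fun z => (n1 z - n2 z) *
         (- (n1 z + n2 z) * (1 + alpha * J * Z2 z)
          - Z2 z ^ 2 * (n1 z ^ 4 + n1 z ^ 3 * n2 z + n1 z ^ 2 * n2 z ^ 2 + n1 z * n2 z ^ 3 + n2 z ^ 4
                     - b1 * ((n1 z + n2 z) * (n1 z ^ 2 + n2 z ^ 2)))
          - (n1 z ^ 2 + n1 z * n2 z + n2 z ^ 2 - J ^ 2) * W2 z)
         + (b1 - b2) * (n2 z ^ 4 * Z2 z ^ 2))
      (fun z => mu (n1 z)) u v kap M'); [lra|assumption|exact HcontV| | | | | |].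
    - intros z Hz Hz0. apply (is_derive_minus Z1 Z2).
      + apply (flow_dZ _ _ _ _ _ _ F1); [lra|assumption|]. destruct (Hnear1 z Hz); lra.
      + apply (flow_dZ _ _ _ _ _ _ F2); [lra|assumption|]. destruct (Hnear2 z Hz); lra.
    - intros z Hz Hz0. apply (flow_mu_sign _ _ _ _ _ _ F1); [lra|assumption].
    - rewrite (flow_sonic _ _ _ _ _ _ F1). unfold mu. ring.
    - intros z Hz.
      assert (Q1 : mu (n1 z) * W1 z = rate b1 (n1 z) (Z1 z)).
      { apply (flow_mu_quotient _ _ _ _ _ _ F1). lra. }
      assert (Q2 : mu (n2 z) * W2 z = rate b2 (n2 z) (Z2 z)).
      { apply (flow_mu_quotient _ _ _ _ _ _ F2). lra. }
      replace (mu (n1 z) * (W1 z - W2 z))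
        with (mu (n1 z) * W1 z - mu (n2 z) * W2 z - (mu (n1 z) - mu (n2 z)) * W2 z) by ring.
      rewrite Q1, Q2. unfold V, rate, mu. ring.
    - intros z Hz. destruct (Hnear1 z Hz) as [[Hn _] _].
      assert (H4 := kappa0_le b1 (n1 z) ltac:(lra) Hn).
      assert (Q1 : z1 <= Z1 z) by now apply HZ1. assert (Q2 : z1 <= Z2 z) by now apply HZ2.
      assert (0 <= alpha * J * n1 z ^ 2).
      { apply Rmult_le_pos; [apply Rmult_le_pos; lra|apply pow2_ge_0]. }
      assert (kappa0 * (2 * z1) <= n1 z ^ 4 * (n1 z - b1) * (Z1 z + Z2 z)).
      { apply Rmult_le_compat; lra. }
      unfold kap. lra.
    - intros z Hz.
      destruct (flow_bounds _ _ _ _ _ _ F1 z ltac:(lra)) as [G1 [_ G2]].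
      destruct (flow_bounds _ _ _ _ _ _ F2 z ltac:(lra)) as [G3 _].
      assert (G4 : Rabs (Z2 z) <= z2).
      { assert (Q2 : z1 <= Z2 z <= z2) by now apply HZ2. rewrite Rabs_pos_eq; lra. }
      replace (kap * M') with (M * (/ z1) ^ 2 * y0 * q + beta * q') by (unfold M'; field; lra).
      apply Rabs_add_le; apply Rabs_mult_le.
      + now apply HN.
      + apply Hq; try assumption. now apply HW2.
      + apply Rle_refl.
      + now apply Hq'. }
  assert (HMb : M <= cV * beta).
  { assert (HMM := HV t Ht). fold M in HMM.
    assert (M' <= M / 2 + q' * beta / kap).
    { unfold M'.
      replace ((q * (M * (/ z1) ^ 2 * y0) + q' * beta) / kap)
        with (M * (q * (y0 / (kap * z1 ^ 2))) + q' * beta / kap) by (field; lra).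
      assert (q * (y0 / (kap * z1 ^ 2)) <= 1 / 2); [|nra].
      assert (Hkz : 0 < kap * z1 ^ 2) by (apply Rmult_lt_0_compat; lra).
      apply Rle_trans with (q * (/ (2 * (q + 1)))).
      - apply Rmult_le_compat_l; [assumption|].
        apply (Rmult_le_reg_r (kap * z1 ^ 2)); [assumption|].
        unfold Rdiv at 1. rewrite Rmult_assoc, Rinv_l, Rmult_1_r by lra.
        unfold Rdiv in Hy03. lra.
      - apply (Rmult_le_reg_r (2 * (q + 1))); [lra|].
        rewrite Rmult_assoc, Rinv_l by lra. lra. }
    unfold cV. replace (2 * q' / kap * beta) with (2 * (q' * beta / kap)) by (field; lra).
    lra. }
  assert (HPb : forall z, u <= z <= v -> Rabs (P1 z - P2 z) <= cP * beta).
  { intros z Hz. eapply Rle_trans; [now apply HPV|]. unfold cP.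
    assert (0 <= (/ z1) ^ 2) by apply pow2_ge_0. nra. }
  assert (HNb : forall z, u <= z <= v -> Rabs (n1 z - n2 z) <= cP * beta).
  { intros z Hz. eapply Rle_trans; [now apply HN|]. unfold cP.
    assert (0 <= (/ z1) ^ 2) by apply pow2_ge_0.
    assert (M * (/ z1) ^ 2 <= cV * beta * (/ z1) ^ 2) by (apply Rmult_le_compat_r; lra).
    assert (0 <= M * (/ z1) ^ 2) by (apply Rmult_le_pos; lra).
    assert (M * (/ z1) ^ 2 * y0 <= M * (/ z1) ^ 2 * 1) by (apply Rmult_le_compat_l; lra). lra. }
  assert (0 <= cP * beta) by (apply Rmult_le_pos; lra).
  split; [|split].
  - assert (H1 := HNb y Hyuv). lra.
  - replace (E1 y - E2 y) with ((E1 y - E2 y) - (E1 0 - E2 0)).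
    2: { rewrite (flow_E0 _ _ _ _ _ _ F1), (flow_E0 _ _ _ _ _ _ F2). ring. }
    apply Rle_trans with ((cP + 1) * beta * y0); [|].
    2: { assert (0 <= (cP + 1) * beta) by (apply Rmult_le_pos; lra). nra. }
    apply (from_0 (fun z => E1 z - E2 z) (fun z => (n1 z - b1) - (n2 z - b2)));
      [|intros x| |assumption].
    + apply Rmult_le_pos; lra.
    + apply (is_derive_minus E1 E2); [apply (flow_E _ _ _ _ _ _ F1)|apply (flow_E _ _ _ _ _ _ F2)].
    + intros z Hz. replace (n1 z - b1 - (n2 z - b2)) with ((n1 z - n2 z) - (b1 - b2)) by ring.
      replace ((cP + 1) * beta) with (cP * beta + beta) by ring.
      apply Rabs_sub_le; [now apply HNb|apply Rle_refl].
  - assert (H1 := HPb y Hyuv). lra.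
Qed.

(** * Continuation of the comparison beyond the window *)

Lemma field_lipschitz (eta Em : R) : 0 < eta -> exists C, 0 <= C /\
  forall m1 e1 m2 e2, Rabs m1 <= r -> Rabs e1 <= Em -> Rabs m2 <= r -> Rabs e2 <= Em ->
  eta <= Rabs (m1 ^ 2 - J ^ 2) -> eta <= Rabs (m2 ^ 2 - J ^ 2) ->
  Rabs ((m1 * e1 - alpha * J) * m1 ^ 2 / (m1 ^ 2 - J ^ 2)
        - (m2 * e2 - alpha * J) * m2 ^ 2 / (m2 ^ 2 - J ^ 2))
    <= C * (Rabs (m1 - m2) + Rabs (e1 - e2)).
Proof.
  intros Heta.
  assert (HQ : exists C, forall m1 e1 m2 e2 i1 i2, Rabs m1 <= r -> Rabs e1 <= Em -> Rabs m2 <= r ->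
    Rabs e2 <= Em -> Rabs i1 <= / eta -> Rabs i2 <= / eta ->
    Rabs ((e2 * m1 ^ 2 + (m2 * e2 - alpha * J) * (m1 + m2)) * i1
          - (m2 * e2 - alpha * J) * m2 ^ 2 * (m1 + m2) * (i1 * i2)) <= C).
  { eexists. intros. bound_Rabs. }
  destruct HQ as [C1 HC1].
  assert (HQ : exists C, forall m1 i1, Rabs m1 <= r -> Rabs i1 <= / eta ->
    Rabs (m1 * m1 ^ 2 * i1) <= C).
  { eexists. intros. bound_Rabs. }
  destruct HQ as [C2 HC2].
  exists (Rabs C1 + Rabs C2). split.
  { assert (0 <= Rabs C1) by apply Rabs_pos. assert (0 <= Rabs C2) by apply Rabs_pos. lra. }
  intros m1 e1 m2 e2 H1 H2 H3 H4 H5 H6.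
  assert (N1 : m1 ^ 2 - J ^ 2 <> 0) by (intros H; rewrite H, Rabs_R0 in H5; lra).
  assert (N2 : m2 ^ 2 - J ^ 2 <> 0) by (intros H; rewrite H, Rabs_R0 in H6; lra).
  assert (I1 := Rabs_inv_le _ _ Heta H5). assert (I2 := Rabs_inv_le _ _ Heta H6).
  set (i1 := / (m1 ^ 2 - J ^ 2)) in *. set (i2 := / (m2 ^ 2 - J ^ 2)) in *.
  replace ((m1 * e1 - alpha * J) * m1 ^ 2 / (m1 ^ 2 - J ^ 2)
           - (m2 * e2 - alpha * J) * m2 ^ 2 / (m2 ^ 2 - J ^ 2))
    with ((m1 - m2) * ((e2 * m1 ^ 2 + (m2 * e2 - alpha * J) * (m1 + m2)) * i1
            - (m2 * e2 - alpha * J) * m2 ^ 2 * (m1 + m2) * (i1 * i2))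
          + (e1 - e2) * (m1 * m1 ^ 2 * i1)) by (unfold i1, i2; field; split; assumption).
  assert (K1 := HC1 m1 e1 m2 e2 i1 i2 H1 H2 H3 H4 I1 I2).
  assert (K2 := HC2 m1 i1 H1 I1).
  assert (A1 := Rle_abs C1). assert (A2 := Rle_abs C2).
  assert (P1 := Rabs_pos C1). assert (P2 := Rabs_pos C2).
  assert (Q1 := Rabs_pos (m1 - m2)). assert (Q2 := Rabs_pos (e1 - e2)).
  apply Rle_trans with (Rabs (m1 - m2) * Rabs C1 + Rabs (e1 - e2) * Rabs C2).
  - apply Rabs_add_le; apply Rabs_mult_le; lra.
  - nra.
Qed.

(** Gronwall's inequality starts at [y0] or [- y0], where the near estimate still holds. Only
    interior points are treated, since the window estimates use derivatives of [P], available only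
    there. *)
Lemma flows_close_open : exists C, 0 < C /\
  forall b1 A1 B1 n1 E1 P1 b2 A2 B2 n2 E2 P2,
  flow b1 A1 B1 n1 E1 P1 -> flow b2 A2 B2 n2 E2 P2 ->
  forall y, -A1 < y < B1 -> -A2 < y < B2 ->
  close C (Rabs (b1 - b2)) n1 E1 P1 n2 E2 P2 y y.
Proof.
  destruct flows_close_near as [y0 [C0 [Hy0 [HC0 Hnear]]]].
  destruct (far_from_sonic y0 Hy0) as [eta [Heta Hfar]].
  destruct (field_lipschitz eta (alpha + (r + k) * L) Heta) as [K [HK Hlip]].
  (* [K'] is the growth rate of [Psi] below, after its mixed products are split into squares. [X]
     carries the initial bound [(2 C0^2 + 1) beta^2] over a length at most [L], and [1 <= X] allows
     passing from [X beta^2] to [(X beta)^2]. *)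
  set (K' := 3 * K + 3).
  set (X := (2 * C0 ^ 2 + 1) * exp (K' * L)).
  assert (HC02 : 0 <= C0 ^ 2) by apply pow2_ge_0.
  assert (HX : 1 <= X).
  { assert (1 <= exp (K' * L)).
    { assert (H : 0 <= K' * L) by (apply Rmult_le_pos; unfold K'; lra).
      assert (H1 := exp_ineq1_le (K' * L)). lra. }
    unfold X. replace 1 with (1 * 1) at 1 by ring. apply Rmult_le_compat; lra. }
  exists (C0 + X + K * (2 * X)).
  assert (HKX : 0 <= K * (2 * X)) by (apply Rmult_le_pos; lra).
  split; [lra|].
  intros b1 A1 B1 n1 E1 P1 b2 A2 B2 n2 E2 P2 F1 F2 y Hya Hyb.
  assert (HA1 := flow_A _ _ _ _ _ _ F1). assert (HB1 := flow_B _ _ _ _ _ _ F1).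
  assert (HA2 := flow_A _ _ _ _ _ _ F2). assert (HB2 := flow_B _ _ _ _ _ _ F2).
  assert (HAB := flow_AB _ _ _ _ _ _ F1).
  assert (Hmono : forall e, (forall beta, 0 <= beta -> 
     e <= C0 * beta \/ e <= X * beta \/ e <= K * (2 * X) * beta -> 
     e <= (C0 + X + K * (2 * X)) * beta)).
  { intros e beta Hb He.
    assert (0 <= C0 * beta) by (apply Rmult_le_pos; lra).
    assert (0 <= X * beta) by (apply Rmult_le_pos; lra).
    assert (0 <= K * (2 * X) * beta) by (apply Rmult_le_pos; lra).
    rewrite !Rmult_plus_distr_r. lra. }
  set (beta := Rabs (b1 - b2)).
  assert (Hbeta : 0 <= beta) by apply Rabs_pos.
  destruct (Rle_lt_dec (Rabs y) y0) as [Hn|Hf].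
  { destruct (Hnear _ _ _ _ _ _ _ _ _ _ _ _ F1 F2 y Hya Hyb Hn) as [H1 [H2 H3]].
    split; [|split]; apply Hmono; auto. }
  (* The constant [beta ^ 2] absorbs the forcing [b1 - b2] in the equation for [E1 - E2], so the
     differential inequality is homogeneous. *)
  set (Psi := fun z => (n1 z - n2 z) ^ 2 + (E1 z - E2 z) ^ 2 + beta ^ 2).
  set (dPsi := fun z => 2 * (n1 z - n2 z) * (P1 z - P2 z)
                        + 2 * (E1 z - E2 z) * ((n1 z - b1) - (n2 z - b2))).
  assert (HP : forall z, -A1 < z < B1 -> -A2 < z < B2 -> y0 <= Rabs z ->
            Rabs (P1 z - P2 z) <= K * (Rabs (n1 z - n2 z) + Rabs (E1 z - E2 z))).
  { intros z Hz1 Hz2 Hz.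
    assert (z <> 0) by (intros ->; rewrite Rabs_R0 in Hz; lra).
    destruct (flow_bounds _ _ _ _ _ _ F1 z ltac:(lra)) as [G1 [G2 _]].
    destruct (flow_bounds _ _ _ _ _ _ F2 z ltac:(lra)) as [G3 [G4 _]].
    rewrite (flow_P_eq _ _ _ _ _ _ F1 z), (flow_P_eq _ _ _ _ _ _ F2 z) by lra.
    apply Hlip; try assumption.
    - now apply (Hfar _ _ _ _ _ _ F1).
    - now apply (Hfar _ _ _ _ _ _ F2). }
  assert (HdPsi : forall z, is_derive Psi z (dPsi z)).
  { intros z.
    assert (D1 := flow_n _ _ _ _ _ _ F1 z). assert (D2 := flow_n _ _ _ _ _ _ F2 z).
    assert (D3 := flow_E _ _ _ _ _ _ F1 z). assert (D4 := flow_E _ _ _ _ _ _ F2 z).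
    unfold Psi. derive_hyps. auto_derive; [split_conj|].
    rewrite_derive. unfold dPsi. ring. }
  assert (HPsi : forall z, -A1 < z < B1 -> -A2 < z < B2 -> y0 <= Rabs z ->
            Rabs (dPsi z) <= K' * Psi z).
  { intros z Hz1 Hz2 Hz. assert (HPz := HP z Hz1 Hz2 Hz).
    unfold dPsi, Psi, K'.
    replace (n1 z - b1 - (n2 z - b2)) with ((n1 z - n2 z) - (b1 - b2)) by ring.
    rewrite <- (pow2_abs (n1 z - n2 z)), <- (pow2_abs (E1 z - E2 z)).
    set (N := Rabs (n1 z - n2 z)) in *. set (D := Rabs (E1 z - E2 z)) in *.
    assert (HN : 0 <= N) by apply Rabs_pos. assert (HD : 0 <= D) by apply Rabs_pos.
    apply Rle_trans with (2 * N * (K * (N + D)) + 2 * D * (N + beta)).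
    - apply Rabs_add_le; apply Rabs_mult_le; try assumption.
      + rewrite Rabs_mult, (Rabs_pos_eq 2) by lra. apply Rle_refl.
      + rewrite Rabs_mult, (Rabs_pos_eq 2) by lra. apply Rle_refl.
      + apply Rabs_sub_le; apply Rle_refl.
    - assert (0 <= K * (N - D) ^ 2) by (apply Rmult_le_pos; [lra|apply pow2_ge_0]).
      assert (0 <= (N - D) ^ 2) by apply pow2_ge_0.
      assert (0 <= (D - beta) ^ 2) by apply pow2_ge_0.
      assert (0 <= N ^ 2) by apply pow2_ge_0.
      assert (0 <= D ^ 2) by apply pow2_ge_0.
      assert (0 <= K * D ^ 2) by (apply Rmult_le_pos; lra).
      assert (0 <= K * N ^ 2) by (apply Rmult_le_pos; lra).
      assert (0 <= beta ^ 2) by apply pow2_ge_0.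
      assert (0 <= K * beta ^ 2) by (apply Rmult_le_pos; lra).
      lra. }
  assert (Hstart : forall z, -A1 < z < B1 -> -A2 < z < B2 -> Rabs z <= y0 ->
            Psi z <= (2 * C0 ^ 2 + 1) * beta ^ 2).
  { intros z Hz1 Hz2 Hz.
    destruct (Hnear _ _ _ _ _ _ _ _ _ _ _ _ F1 F2 z Hz1 Hz2 Hz) as [H1 [H2 _]].
    fold beta in H1, H2. unfold Psi.
    assert ((n1 z - n2 z) ^ 2 <= (C0 * beta) ^ 2) by now apply pow_maj_Rabs.
    assert ((E1 z - E2 z) ^ 2 <= (C0 * beta) ^ 2) by now apply pow_maj_Rabs.
    rewrite Rpow_mult_distr in *. lra. }
  assert (Hend : Psi y <= X * beta ^ 2).
  { assert (Hgo : forall z t, Psi z <= (2 * C0 ^ 2 + 1) * beta ^ 2 -> 0 <= t <= L ->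
              Psi z * exp (K' * t) <= X * beta ^ 2).
    { intros z t Hz Ht.
      assert (Hp : 0 <= Psi z).
      { unfold Psi. assert (0 <= (n1 z - n2 z) ^ 2) by apply pow2_ge_0.
        assert (0 <= (E1 z - E2 z) ^ 2) by apply pow2_ge_0.
        assert (0 <= beta ^ 2) by apply pow2_ge_0. lra. }
      unfold X. replace ((2 * C0 ^ 2 + 1) * exp (K' * L) * beta ^ 2)
        with ((2 * C0 ^ 2 + 1) * beta ^ 2 * exp (K' * L)) by ring.
      apply Rmult_le_compat; [assumption|left; apply exp_pos|assumption|].
      destruct (Req_dec t L) as [->|]; [apply Rle_refl|].
      left. apply exp_increasing. apply Rmult_lt_compat_l; [unfold K'|]; lra. }
    destruct (Rle_lt_dec y 0) as [Hs|Hs].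
    - rewrite Rabs_left1 in Hf by lra.
      destruct (gronwall Psi dPsi K' y (- y0)) as [_ H]; [lra|auto| |].
      + intros x Hx. apply HPsi; [lra|lra|]. rewrite Rabs_left1; lra.
      + eapply Rle_trans; [exact H|]. apply Hgo; [|lra].
        apply Hstart; [lra|lra|]. rewrite Rabs_left1; lra.
    - rewrite Rabs_pos_eq in Hf by lra.
      destruct (gronwall Psi dPsi K' y0 y) as [H _]; [lra|auto| |].
      + intros x Hx. apply HPsi; [lra|lra|]. rewrite Rabs_pos_eq; lra.
      + eapply Rle_trans; [exact H|]. apply Hgo; [|lra].
        apply Hstart; [lra|lra|]. rewrite Rabs_pos_eq; lra. }
  assert (Hsq : Psi y <= (X * beta) ^ 2).
  { rewrite Rpow_mult_distr. eapply Rle_trans; [exact Hend|].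
    apply Rmult_le_compat_r; [apply pow2_ge_0|nra]. }
  assert (HXb : 0 <= X * beta) by (apply Rmult_le_pos; lra).
  assert (S1 : 0 <= (n1 y - n2 y) ^ 2) by apply pow2_ge_0.
  assert (S2 : 0 <= (E1 y - E2 y) ^ 2) by apply pow2_ge_0.
  assert (S3 : 0 <= beta ^ 2) by apply pow2_ge_0.
  unfold Psi in Hsq.
  assert (T1 : Rabs (n1 y - n2 y) <= X * beta) by (apply pow2_le_Rabs; lra).
  assert (T2 : Rabs (E1 y - E2 y) <= X * beta) by (apply pow2_le_Rabs; lra).
  split; [|split]; apply Hmono; auto.
  right. right. eapply Rle_trans; [apply HP; lra|].
  rewrite Rmult_assoc. apply Rmult_le_compat_l; lra.
Qed.

Lemma flows_close : exists C, 0 < C /\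
  forall b1 A1 B1 n1 E1 P1 b2 A2 B2 n2 E2 P2,
  flow b1 A1 B1 n1 E1 P1 -> flow b2 A2 B2 n2 E2 P2 ->
  forall y, -A1 <= y <= B1 -> -A2 <= y <= B2 ->
  close C (Rabs (b1 - b2)) n1 E1 P1 n2 E2 P2 y y.
Proof.
  destruct flows_close_open as [C [HC Hopen]].
  exists C. split; [assumption|].
  intros b1 A1 B1 n1 E1 P1 b2 A2 B2 n2 E2 P2 F1 F2 y Hya Hyb.
  assert (HA1 := flow_A _ _ _ _ _ _ F1). assert (HB1 := flow_B _ _ _ _ _ _ F1).
  assert (HA2 := flow_A _ _ _ _ _ _ F2). assert (HB2 := flow_B _ _ _ _ _ _ F2).
  assert (Hcl : forall f1 f2 : R -> R, (forall x, continuous f1 x) -> (forall x, continuous f2 x) ->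
     (forall z, -A1 < z < B1 -> -A2 < z < B2 -> Rabs (f1 z - f2 z) <= C * Rabs (b1 - b2)) ->
     Rabs (f1 y - f2 y) <= C * Rabs (b1 - b2)).
  { intros f1 f2 Hf1 Hf2 Hf.
    assert (M1 := Rmax_l (-A1) (-A2)). assert (M2 := Rmax_r (-A1) (-A2)).
    assert (M3 := Rmin_l B1 B2). assert (M4 := Rmin_r B1 B2).
    apply (closed_bound (fun y => Rabs (f1 y - f2 y)) _ (Rmax (-A1) (-A2)) (Rmin B1 B2)).
    - apply Rmax_case; apply Rmin_case; lra.
    - intros x Hx. prove_continuous; auto.
    - intros x Hx. apply Hf; lra.
    - split; [apply Rmax_case|apply Rmin_case]; lra. }
  split; [|split]; apply Hcl.
  - apply (cont_n _ _ _ _ _ _ F1).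
  - apply (cont_n _ _ _ _ _ _ F2).
  - intros z Hz1 Hz2. now destruct (Hopen _ _ _ _ _ _ _ _ _ _ _ _ F1 F2 z Hz1 Hz2).
  - apply (cont_E _ _ _ _ _ _ F1).
  - apply (cont_E _ _ _ _ _ _ F2).
  - intros z Hz1 Hz2. now destruct (Hopen _ _ _ _ _ _ _ _ _ _ _ _ F1 F2 z Hz1 Hz2).
  - apply (flow_P _ _ _ _ _ _ F1).
  - apply (flow_P _ _ _ _ _ _ F2).
  - intros z Hz1 Hz2. now destruct (Hopen _ _ _ _ _ _ _ _ _ _ _ _ F1 F2 z Hz1 Hz2).
Qed.

(** For [B1 <= B2], [n2] rises by at least [c (B2 - B1)] on [[B1, B2]]. That rise is at most the
    distance of the two profiles at [B1] plus the difference of the right data. *)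
Lemma sonic_point_stability : exists C, 0 < C /\
  forall b1 A1 B1 n1 E1 P1 b2 A2 B2 n2 E2 P2,
  flow b1 A1 B1 n1 E1 P1 -> flow b2 A2 B2 n2 E2 P2 ->
  Rabs (B1 - B2) <= C * (Rabs (b1 - b2) + Rabs (n1 B1 - n2 B2)).
Proof.
  destruct flows_close as [C [HC Hclose]].
  destruct flow_P_lower as [c [Hc HP]].
  assert (Hmain : forall b1 A1 B1 n1 E1 P1 b2 A2 B2 n2 E2 P2,
    flow b1 A1 B1 n1 E1 P1 -> flow b2 A2 B2 n2 E2 P2 -> B1 <= B2 ->
    B2 - B1 <= (C + 1) / c * (Rabs (b1 - b2) + Rabs (n1 B1 - n2 B2))).
  { intros b1 A1 B1 n1 E1 P1 b2 A2 B2 n2 E2 P2 F1 F2 HB.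
    assert (HA1 := flow_A _ _ _ _ _ _ F1). assert (HB1 := flow_B _ _ _ _ _ _ F1).
    assert (HA2 := flow_A _ _ _ _ _ _ F2).
    assert (Hg : c * (B2 - B1) <= n2 B2 - n2 B1).
    { destruct (Req_dec B1 B2) as [->|]; [lra|].
      destruct (mean_value n2 P2 B1 B2) as [x [Hx He]]; [lra| | |].
      - intros; apply (cont_n _ _ _ _ _ _ F2).
      - intros x Hx. exact (flow_n _ _ _ _ _ _ F2 x).
      - rewrite He. apply Rmult_le_compat_r; [lra|].
        apply (HP _ _ _ _ _ _ F2). lra. }
    destruct (Hclose _ _ _ _ _ _ _ _ _ _ _ _ F1 F2 B1) as [H1 _]; [lra|lra|].
    assert (H2 : n2 B2 - n2 B1 <= Rabs (n1 B1 - n2 B1) + Rabs (n1 B1 - n2 B2)).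
    { replace (n2 B2 - n2 B1) with ((n1 B1 - n2 B1) - (n1 B1 - n2 B2)) by ring.
      eapply Rle_trans; [apply Rle_abs|]. apply Rabs_sub_le; apply Rle_refl. }
    assert (P1' := Rabs_pos (b1 - b2)). assert (P2' := Rabs_pos (n1 B1 - n2 B2)).
    apply (Rmult_le_reg_l c); [assumption|].
    replace (c * ((C + 1) / c * (Rabs (b1 - b2) + Rabs (n1 B1 - n2 B2))))
      with ((C + 1) * (Rabs (b1 - b2) + Rabs (n1 B1 - n2 B2))) by (field; lra).
    assert (0 <= C * Rabs (n1 B1 - n2 B2)) by (apply Rmult_le_pos; lra).
    lra. }
  exists ((C + 1) / c). split; [apply Rdiv_lt_0_compat; lra|].
  intros b1 A1 B1 n1 E1 P1 b2 A2 B2 n2 E2 P2 F1 F2.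
  destruct (Rle_lt_dec B1 B2) as [H|H].
  - rewrite Rabs_left1 by lra. rewrite Ropp_minus_distr.
    exact (Hmain _ _ _ _ _ _ _ _ _ _ _ _ F1 F2 H).
  - rewrite Rabs_pos_eq by lra.
    rewrite (Rabs_minus_sym b1), (Rabs_minus_sym (n1 B1)).
    apply (Hmain _ _ _ _ _ _ _ _ _ _ _ _ F2 F1). lra.
Qed.

Lemma flow_lipschitz : exists C, 0 <= C /\
  forall b A B n E P, flow b A B n E P -> forall y z, -A <= y <= B -> -A <= z <= B ->
  close C (Rabs (y - z)) n E P n E P y z.
Proof.
  destruct flow_P_lipschitz as [C HC].
  exists (Rabs C + (r + k)).
  assert (HC0 := Rabs_pos C). assert (HC1 := Rle_abs C).
  split; [lra|].
  assert (Hmain : forall b A B n E P, flow b A B n E P ->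
    forall y z, -A <= y <= z -> z <= B ->
    close (Rabs C + (r + k)) (Rabs (z - y)) n E P n E P z y).
  { intros b A B n E P F y z Hy Hz.
    destruct (HC _ _ _ _ _ _ F) as [H1 H2].
    unfold close. rewrite (Rabs_pos_eq (z - y)) by lra. split; [|split].
    - apply lipschitz_of_derive with P; [lra| | |].
      + intros; apply (cont_n _ _ _ _ _ _ F).
      + intros; apply (flow_n _ _ _ _ _ _ F).
      + intros x Hx. assert (H := H1 x ltac:(lra)). lra.
    - apply lipschitz_of_derive with (fun x => n x - b); [lra| | |].
      + intros; apply (cont_E _ _ _ _ _ _ F).
      + intros; apply (flow_E _ _ _ _ _ _ F).
      + intros x Hx. destruct (flow_bounds _ _ _ _ _ _ F x ltac:(lra)) as [G1 [_ G2]].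
        assert (H := Rabs_sub_le _ _ _ _ G1 G2). lra.
    - apply lipschitz_of_derive_but_0 with (fun y => dP b (n y) (E y) (P y)); [lra| | |].
      + intros; apply (flow_P _ _ _ _ _ _ F).
      + intros x Hx Hx0. apply (flow_dP _ _ _ _ _ _ F); [lra|assumption].
      + intros x Hx Hx0. assert (H := H2 x ltac:(lra) Hx0). lra. }
  intros b A B n E P F y z Hy Hz.
  destruct (Rle_lt_dec z y) as [H|H].
  - now apply (Hmain _ _ _ _ _ _ F).
  - destruct (Hmain _ _ _ _ _ _ F y z) as [K1 [K2 K3]]; [lra|lra|].
    unfold close. rewrite (Rabs_minus_sym y), (Rabs_minus_sym (n y)), (Rabs_minus_sym (E y)),
      (Rabs_minus_sym (P y)). auto.
Qed.

Lemma flow_stability : exists C, 0 < C /\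
  forall b1 A1 B1 n1 E1 P1 b2 A2 B2 n2 E2 P2,
  flow b1 A1 B1 n1 E1 P1 -> flow b2 A2 B2 n2 E2 P2 ->
  forall x, 0 <= x <= L ->
  close C (Rabs (b1 - b2) + Rabs (n1 B1 - n2 B2)) n1 E1 P1 n2 E2 P2 (x - A1) (x - A2).
Proof.
  destruct flows_close as [C1 [HC1 Hclose]].
  destruct sonic_point_stability as [C2 [HC2 Hson]].
  destruct flow_lipschitz as [C3 [HC3 Hlip]].
  assert (H23 : 0 <= C3 * C2) by (apply Rmult_le_pos; lra).
  exists (C1 + 2 * (C3 * C2)). split; [lra|].
  intros b1 A1 B1 n1 E1 P1 b2 A2 B2 n2 E2 P2 F1 F2 x Hx.
  assert (HAB1 := flow_AB _ _ _ _ _ _ F1). assert (HAB2 := flow_AB _ _ _ _ _ _ F2).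
  assert (HA1 := flow_A _ _ _ _ _ _ F1). assert (HB1 := flow_B _ _ _ _ _ _ F1).
  assert (HA2 := flow_A _ _ _ _ _ _ F2). assert (HB2 := flow_B _ _ _ _ _ _ F2).
  set (del := Rabs (b1 - b2) + Rabs (n1 B1 - n2 B2)).
  assert (Hs := Hson _ _ _ _ _ _ _ _ _ _ _ _ F1 F2). fold del in Hs.
  (* As [A1 + B1 = A2 + B2], the points [x - A1] and [x - A2] are [|B1 - B2|] apart. The point [y]
     lies between them and in both intervals, so both solutions can be evaluated there. *)
  assert (Hy : exists y, (-A1 <= y <= B1) /\ (-A2 <= y <= B2) /\
     Rabs (x - A1 - y) <= Rabs (B1 - B2) /\ Rabs (y - (x - A2)) <= Rabs (B1 - B2)).
  { destruct (Rle_lt_dec B1 B2).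
    - rewrite (Rabs_left1 (B1 - B2)) by lra. exists (Rmin (x - A2) B1).
      apply Rmin_case_strong; intros; (split; [lra|split; [lra|]]);
        split; apply Rabs_le; split; lra.
    - rewrite (Rabs_pos_eq (B1 - B2)) by lra. exists (Rmin (x - A1) B2).
      apply Rmin_case_strong; intros; (split; [lra|split; [lra|]]);
        split; apply Rabs_le; split; lra. }
  destruct Hy as [y [Hy1 [Hy2 [Hy3 Hy4]]]].
  destruct (Hclose _ _ _ _ _ _ _ _ _ _ _ _ F1 F2 y Hy1 Hy2) as [K1 [K2 K3]].
  destruct (Hlip _ _ _ _ _ _ F1 (x - A1) y) as [L1 [L2 L3]]; [lra|lra|].
  destruct (Hlip _ _ _ _ _ _ F2 y (x - A2)) as [M1 [M2 M3]]; [lra|lra|].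
  assert (Hb : C1 * Rabs (b1 - b2) <= C1 * del).
  { apply Rmult_le_compat_l; [lra|]. unfold del.
    assert (H := Rabs_pos (n1 B1 - n2 B2)). lra. }
  assert (Hq : forall d, d <= Rabs (B1 - B2) -> C3 * d <= C3 * C2 * del).
  { intros d Hd. rewrite Rmult_assoc. apply Rmult_le_compat_l; lra. }
  assert (Q1 := Hq _ Hy3). assert (Q2 := Hq _ Hy4).
  assert (Htri : forall f1 f2 : R -> R,
    Rabs (f1 (x - A1) - f1 y) <= C3 * Rabs (x - A1 - y) ->
    Rabs (f1 y - f2 y) <= C1 * Rabs (b1 - b2) ->
    Rabs (f2 y - f2 (x - A2)) <= C3 * Rabs (y - (x - A2)) ->
    Rabs (f1 (x - A1) - f2 (x - A2)) <= (C1 + 2 * (C3 * C2)) * del).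
  { intros f1 f2 T1 T2 T3.
    replace (f1 (x - A1) - f2 (x - A2))
      with ((f1 (x - A1) - f1 y) + (f1 y - f2 y) + (f2 y - f2 (x - A2))) by ring.
    eapply Rle_trans; [apply Rabs_add_le; [apply Rabs_add_le|]; [exact T1|exact T2|exact T3]|].
    lra. }
  split; [|split]; apply Htri; assumption.
Qed.

End Flow.

(** * Relative derivatives on an interval *)

Lemma ball_R (x e y : R) : ball x e y <-> Rabs (y - x) < e.
Proof. reflexivity. Qed.

Lemma is_derive_on_of_is_derive (a b : R) (f F : R -> R) (x l : R) :
  is_derive F x l -> (forall y, a <= y <= b -> f y = F y) -> a <= x <= b ->
  is_derive_on a b f x l.
Proof.
  intros HF Hf Hx. apply filterlim_locally. intros eps.
  apply is_derive_Reals in HF. destruct (HF eps (cond_pos eps)) as [del Hdel].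
  exists del. intros y Hy Hyx Hyab. simpl in y. apply ball_R. change (Rabs (y - x) < del) in Hy.
  assert (H := Hdel (y - x) ltac:(lra) Hy).
  replace (x + (y - x)) with y in H by ring.
  now rewrite (Hf y), (Hf x).
Qed.

Lemma is_derive_of_is_derive_on (a b : R) (f : R -> R) (x l : R) :
  a < x < b -> is_derive_on a b f x l -> is_derive f x l.
Proof.
  intros Hx Hf. apply is_derive_Reals. intros eps Heps.
  destruct (proj1 (filterlim_locally _ _) Hf (mkposreal eps Heps)) as [del Hdel].
  assert (Hm : 0 < Rmin del (Rmin (x - a) (b - x))).
  { repeat apply Rmin_glb_lt; try lra. apply cond_pos. }
  assert (L1 := Rmin_l del (Rmin (x - a) (b - x))). assert (L2 := Rmin_r del (Rmin (x - a) (b - x))).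
  assert (L3 := Rmin_l (x - a) (b - x)). assert (L4 := Rmin_r (x - a) (b - x)).
  exists (mkposreal _ Hm). intros h Hh Hlt. simpl in Hlt.
  specialize (Hdel (x + h)).
  replace (x + h - x) with h in Hdel by ring.
  apply Hdel.
  - apply ball_R. replace (x + h - x) with h by ring. lra.
  - lra.
  - apply Rabs_def2 in Hlt. lra.
Qed.

Lemma Derive_on_unique (a b : R) (f : R -> R) (x l : R) :
  a < b -> a <= x <= b -> is_derive_on a b f x l -> Derive_on a b f x = l.
Proof.
  intros Hab Hx Hl. unfold Derive_on.
  apply (iota_unique (V := R_CompleteNormedModule)); [|exact Hl].
  intros l' Hl'.
  (* [iota] returns the derivative only if it is unique, hence the filter must be proper: towards
     the farther endpoint, [[a, b]] contains points other than [x] arbitrarily close to it. *)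
  assert (FF : ProperFilter' (within (fun y => a <= y <= b) (locally' x))).
  { constructor; [|apply within_filter, locally'_filter].
    intros [del Hdel].
    assert (Hp := cond_pos del).
    set (h := Rmin (del / 2) ((b - a) / 2)).
    assert (0 < h) by (apply Rmin_glb_lt; lra).
    assert (h <= del / 2) by apply Rmin_l.
    assert (h <= (b - a) / 2) by apply Rmin_r.
    destruct (Rle_lt_dec x ((a + b) / 2)).
    - apply (Hdel (x + h)); [|lra|lra]. apply ball_R. rewrite Rabs_pos_eq; lra.
    - apply (Hdel (x - h)); [|lra|lra]. apply ball_R. rewrite Rabs_left1; lra. }
  exact (filterlim_locally_unique (FF := FF) _ _ _ Hl' Hl).
Qed.

Lemma Derive_on_eq (a b : R) (f F : R -> R) (x l : R) :
  a < b -> is_derive F x l -> (forall y, a <= y <= b -> f y = F y) -> a <= x <= b ->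
  Derive_on a b f x = l.
Proof.
  intros Hab HF Hf Hx. apply Derive_on_unique; try assumption.
  now apply (is_derive_on_of_is_derive a b f F).
Qed.

Lemma Derive_on_correct (a b : R) (f : R -> R) (x : R) :
  a < b -> a <= x <= b -> ex_derive_on a b f x -> is_derive_on a b f x (Derive_on a b f x).
Proof.
  intros Hab Hx [l Hl]. now rewrite (Derive_on_unique a b f x l).
Qed.

Lemma continuous_on_of_ex_derive_on (a b : R) (f : R -> R) :
  (forall x, a <= x <= b -> ex_derive_on a b f x) ->
  continuous_on (fun x => a <= x <= b) f.
Proof.
  intros Hf x Hx. simpl in x. destruct (Hf x Hx) as [l Hl].
  apply filterlim_locally. intros eps.
  destruct (proj1 (filterlim_locally _ _) Hl (mkposreal 1 Rlt_0_1)) as [del Hdel].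
  assert (Hp := cond_pos eps). assert (Hal := Rabs_pos l).
  assert (Hm : 0 < Rmin del (eps / (Rabs l + 1))).
  { apply Rmin_glb_lt; [apply cond_pos|apply Rdiv_lt_0_compat; lra]. }
  assert (L1 := Rmin_l del (eps / (Rabs l + 1))). assert (L2 := Rmin_r del (eps / (Rabs l + 1))).
  exists (mkposreal _ Hm). intros y Hy Hyab. simpl in y. apply ball_R.
  change (Rabs (y - x) < Rmin del (eps / (Rabs l + 1))) in Hy.
  destruct (Req_dec y x) as [->|Hne].
  { rewrite Rminus_diag, Rabs_R0. assumption. }
  assert (Hq : Rabs ((f y - f x) / (y - x) - l) < 1).
  { apply (Hdel y); [apply ball_R; exact (Rlt_le_trans _ _ _ Hy L1)|assumption|assumption]. }
  set (q := (f y - f x) / (y - x)) in *.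
  replace (f y - f x) with (q * (y - x)) by (unfold q; field; lra).
  assert (Hqb : Rabs q <= Rabs l + 1).
  { replace q with ((q - l) + l) by ring. eapply Rle_trans; [apply Rabs_triang|]. lra. }
  rewrite Rabs_mult.
  apply Rle_lt_trans with ((Rabs l + 1) * Rabs (y - x)).
  - apply Rmult_le_compat_r; [apply Rabs_pos|assumption].
  - apply Rlt_le_trans with ((Rabs l + 1) * (eps / (Rabs l + 1))).
    + apply Rmult_lt_compat_l; [lra|exact (Rlt_le_trans _ _ _ Hy L2)].
    + right. field. lra.
Qed.

(** * Extension from a closed interval to the whole line *)

Definition clamp (a b x : R) := Rmax a (Rmin b x).

Lemma clamp_bounds (a b x : R) : a <= b -> a <= clamp a b x <= b.
Proof. intros. unfold clamp, Rmax, Rmin. repeat destruct Rle_dec; lra. Qed.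

Lemma clamp_id (a b x : R) : a <= x <= b -> clamp a b x = x.
Proof. intros. unfold clamp, Rmax, Rmin. repeat destruct Rle_dec; lra. Qed.

Lemma clamp_nonexpansive (a b x y : R) :
  a <= b -> Rabs (clamp a b y - clamp a b x) <= Rabs (y - x).
Proof.
  intros Hab. unfold clamp, Rmax, Rmin.
  destruct (Rle_dec b x), (Rle_dec b y); repeat destruct Rle_dec;
    apply Rabs_le; unfold Rabs; destruct Rcase_abs; lra.
Qed.

Lemma continuous_clamp (a b x : R) : a <= b -> continuous (clamp a b) x.
Proof.
  intros Hab. apply filterlim_locally. intros eps. exists eps. intros y Hy.
  exact (Rle_lt_trans _ _ _ (clamp_nonexpansive a b x y Hab) Hy).
Qed.

Lemma continuous_comp_clamp (a b : R) (f : R -> R) (x : R) :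
  a <= b -> continuous_on (fun x => a <= x <= b) f -> continuous (fun x => f (clamp a b x)) x.
Proof.
  intros Hab Hf.
  apply (filterlim_comp _ _ _ (clamp a b) f _
           (within (fun x => a <= x <= b) (locally (clamp a b x)))).
  - intros Q HQ.
    assert (H : locally x (fun y => a <= clamp a b y <= b -> Q (clamp a b y))).
    { exact (continuous_clamp a b x Hab _ HQ). }
    change (locally x (fun y => Q (clamp a b y))).
    revert H. apply filter_imp. intros y Hy. exact (Hy (clamp_bounds a b y Hab)).
  - apply Hf. now apply clamp_bounds.
Qed.

(** The primitive of [g] starting from [f 0] has two-sided derivatives everywhere, and its
    difference from [f] is continuous on [[0, L]] with zero derivative inside. *)
Lemma extension (f g : R -> R) (L : R) :
  0 < L -> continuous_on (fun x => 0 <= x <= L) f ->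
  (forall x, continuous g x) -> (forall x, 0 < x < L -> is_derive f x (g x)) ->
  exists F : R -> R, (forall x, is_derive F x (g x)) /\ forall x, 0 <= x <= L -> f x = F x.
Proof.
  intros HL Hf Hg Hfg.
  set (F := fun x => f 0 + RInt g 0 x).
  assert (HF : forall x, is_derive F x (g x)).
  { intros x. unfold F. replace (g x) with (0 + g x) by ring.
    apply (is_derive_plus (fun _ => f 0)); [apply @is_derive_const|].
    apply (is_derive_RInt g (RInt g 0) 0 x); [|apply Hg].
    apply filter_forall. intros y. apply (RInt_correct g).
    apply (ex_RInt_continuous g). intros; apply Hg. }
  exists F. split; [assumption|].
  intros x Hx.
  assert (H0 : F 0 = f 0).
  { unfold F. rewrite RInt_point. unfold zero; simpl. ring. }
  destruct (Req_dec x 0) as [->|Hx0]; [now rewrite H0|].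
  destruct (mean_value (fun y => f (clamp 0 L y) - F y) (fun y => g y - g y) 0 x) as [c [Hc He]];
    [lra| | |].
  - intros y Hy. apply (continuous_minus (V := R_NormedModule)).
    + apply (continuous_comp_clamp 0 L f y); [lra|assumption].
    + apply (ex_derive_continuous (V := R_NormedModule)). now exists (g y).
  - intros y Hy. apply (is_derive_minus (fun y => f (clamp 0 L y)) F); [|apply HF].
    apply (is_derive_ext_loc f); [|apply Hfg; lra].
    assert (Hm : 0 < Rmin y (L - y)) by (apply Rmin_glb_lt; lra).
    assert (L1 := Rmin_l y (L - y)). assert (L2 := Rmin_r y (L - y)).
    exists (mkposreal _ Hm). intros z Hz. change (Rabs (z - y) < Rmin y (L - y)) in Hz.
    apply Rabs_def2 in Hz. rewrite clamp_id; [reflexivity|lra].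
  - rewrite !clamp_id in He by lra. lra.
Qed.

(** * Conclusion *)

Lemma is_derive_shift (f : R -> R) (x s l : R) :
  is_derive f (x + s) l -> is_derive (fun y => f (y + s)) x l.
Proof.
  intros Hf. replace l with (scal 1 l) by (unfold scal; simpl; unfold mult; simpl; ring).
  apply (is_derive_comp f (fun y => y + s)); [assumption|].
  auto_derive; [trivial|ring].
Qed.

Lemma flow_of_transonic (J L alpha k r : R) (HJ : 0 < J) (HL : 0 < L)
    (b nl nr x0 : R) (n E : R -> R) :
  0 < b <= k -> nl < J -> nl <= k -> nr <= r ->
  C1_smooth_transonic_solution J alpha L b nl nr n E x0 ->
  exists n' E' P' : R -> R, flow J L alpha k r b x0 (L - x0) n' E' P' /\
    forall x, 0 <= x <= L -> n x = n' (x - x0) /\ E x = E' (x - x0).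
Proof.
  intros Hb HnlJ Hnl Hnr S.
  destruct S as [[Sn1 Sn2] [SE _] Spos Seq Sl Sr Sx0 Ssup Sson Ssub].
  simpl in Sn2.
  set (D := Derive_on 0 L n) in *.
  (* The derivative of [n], frozen at its endpoint values outside [[0, L]]. Its primitive extends
     [n], and that extension in turn drives the extension of [E]. *)
  set (g := fun x => D (clamp 0 L x)).
  assert (HDint : forall x, 0 < x < L -> is_derive n x (D x)).
  { intros x Hx. apply (is_derive_of_is_derive_on 0 L); [assumption|].
    apply Derive_on_correct; [assumption|lra|]. apply Sn1. lra. }
  assert (HcN := continuous_on_of_ex_derive_on 0 L n Sn1).
  assert (HcE := continuous_on_of_ex_derive_on 0 L E SE).
  assert (Hg : forall x, continuous g x).
  { intros x. apply (continuous_comp_clamp 0 L D); [lra|exact Sn2]. }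
  destruct (extension n g L HL HcN Hg) as [N [HN HnN]].
  { intros x Hx. unfold g. rewrite clamp_id by lra. now apply HDint. }
  assert (HcNN : forall x, continuous N x).
  { intros x. apply (ex_derive_continuous (V := R_NormedModule)). now exists (g x). }
  destruct (extension E (fun x => N x - b) L HL HcE) as [M [HM HEM]].
  { intros x. prove_continuous. apply HcNN. }
  { intros x Hx. rewrite <- HnN by lra. now apply Seq. }
  assert (HcM : forall x, continuous M x).
  { intros x. apply (ex_derive_continuous (V := R_NormedModule)). now exists (N x - b). }
  assert (Hpos : forall x, 0 <= x <= L -> 0 < N x).
  { intros x Hx. rewrite <- HnN by assumption. now apply Spos. }
  (* The system is given on the open interval only. Multiplied out, it is an identity between
     continuous functions and passes to the endpoints, one inequality at a time. *)
  assert (Hode : forall x, 0 <= x <= L ->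
     g x * (N x ^ 2 - J ^ 2) - (N x * M x - alpha * J) * N x ^ 2 = 0).
  { assert (Hopen : forall x, 0 < x < L ->
     g x * (N x ^ 2 - J ^ 2) - (N x * M x - alpha * J) * N x ^ 2 = 0).
    { intros x Hx. destruct (Seq x Hx) as [H1 _].
      assert (Hp := Hpos x ltac:(lra)).
      assert (H2 : is_derive (fun y => n y + J ^ 2 / n y) x (g x * (1 - J ^ 2 / N x ^ 2))).
      { assert (H3 := HDint x Hx). assert (Hpn := Spos x ltac:(lra)).
        derive_hyps. auto_derive; [split_conj; lra|].
        rewrite_derive. unfold g. rewrite clamp_id by lra. rewrite <- HnN by lra.
        field. lra. }
      assert (H3 := eq_trans (eq_sym (is_derive_unique _ _ _ H1)) (is_derive_unique _ _ _ H2)).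
      rewrite HnN, HEM in H3 by lra. rewrite H3. field. lra. }
    intros x Hx. apply Rle_antisym.
    - apply (closed_bound (fun x => g x * (N x ^ 2 - J ^ 2) - (N x * M x - alpha * J) * N x ^ 2)
               0 0 L); [assumption| | |assumption].
      + intros y Hy. prove_continuous; auto.
      + intros y Hy. rewrite Hopen by assumption. lra.
    - apply Ropp_le_cancel. rewrite Ropp_0.
      apply (closed_bound (fun x => (-1) * (g x * (N x ^ 2 - J ^ 2) - (N x * M x - alpha * J) * N x ^ 2))
               0 0 L) with (x := x) in Hx; [lra|assumption| |].
      + intros y Hy. prove_continuous; auto.
      + intros y Hy. rewrite Hopen by assumption. lra. }
  exists (fun y => N (y + x0)), (fun y => M (y + x0)), (fun y => g (y + x0)).
  split.
  - constructor; try lra.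
    + intros y. apply (continuous_comp (fun y => y + x0) g); [|apply Hg].
      prove_continuous. apply continuous_id.
    + intros y. apply is_derive_shift, HN.
    + intros y. apply (is_derive_shift M), HM.
    + intros y Hy. assert (H := Hode (y + x0) ltac:(lra)). lra.
    + intros y Hy. apply Hpos. lra.
    + intros y Hy. rewrite <- HnN by lra.
      (* The supersonic condition covers only the open interval; at the left endpoint [nl < J]
         replaces it. *)
      destruct (Req_dec (y + x0) 0) as [->|]; [lra|]. apply Ssup. lra.
    + rewrite Rplus_0_l, <- HnN; [assumption|lra].
    + intros y Hy. rewrite <- HnN by lra. apply Ssub. lra.
    + rewrite Rplus_opp_l, <- HnN; lra.
    + replace (L - x0 + x0) with L by ring. rewrite <- HnN; lra.
  - intros x Hx. replace (x - x0 + x0) with x by ring. split; [now apply HnN|now apply HEM].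
Qed.

Lemma sup_norm_le (a b : R) (f : R -> R) (K : R) :
  (forall x, a <= x <= b -> Rabs (f x) <= K) -> Rbar_le (sup_norm a b f) (Finite K).
Proof.
  intros Hf. apply (proj2 (Lub_Rbar_correct _)).
  intros y [x [Hx ->]]. now apply Hf.
Qed.

Lemma relaxation_rate_ge_0 (tau : Rbar) : Rbar_lt (Finite 0) tau -> 0 <= relaxation_rate tau.
Proof.
  destruct tau as [t| |]; simpl; intros H.
  - unfold relaxation_rate; simpl. left. now apply Rinv_0_lt_compat.
  - unfold relaxation_rate; simpl. lra.
  - contradiction.
Qed.

Theorem theorem1p3 (J L : R) (tau : Rbar)
    (HJ : 0 < J) (HL : 0 < L) (Htau : Rbar_lt (Finite 0) tau)
    (bmax lmax rmax : R) (Hbmax : bmax < J) (Hlmax : lmax < J) :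
  exists C : R, 0 < C /\
    forall (b1 b2 n1l n2l n1r n2r x1 x2 : R) (n1 E1 n2 E2 : R -> R),
      0 < b1 < J -> 0 < b2 < J ->
      0 < n1l < J -> 0 < n2l < J ->
      J < n1r -> J < n2r ->
      b1 <= bmax -> b2 <= bmax ->
      n1l <= lmax -> n2l <= lmax ->
      n1r <= rmax -> n2r <= rmax ->
      C1_smooth_transonic_solution J (relaxation_rate tau) L b1 n1l n1r n1 E1 x1 ->
      C1_smooth_transonic_solution J (relaxation_rate tau) L b2 n2l n2r n2 E2 x2 ->
      Rbar_le
        (Rbar_plus (Ck_norm 1 0 L (fun x => n1 x - n2 x))
                   (Ck_norm 2 0 L (fun x => E1 x - E2 x)))
        (Finite (C * (Rabs (b1 - b2) + Rabs (n1l - n2l) + Rabs (n1r - n2r)))).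
Proof.
  set (alpha := relaxation_rate tau).
  assert (Halpha : 0 <= alpha) by now apply relaxation_rate_ge_0.
  set (k := Rmax (J / 2) (Rmax bmax lmax)).
  set (r := Rmax J rmax).
  assert (Hk : J / 2 <= k < J).
  { split; [apply Rmax_l|]. repeat apply Rmax_lub_lt; lra. }
  assert (Hkb : bmax <= k) by (eapply Rle_trans; [apply Rmax_l|apply Rmax_r]).
  assert (Hkl : lmax <= k) by (eapply Rle_trans; [apply Rmax_r|apply Rmax_r]).
  assert (HrJ : J <= r) by apply Rmax_l.
  assert (Hrr : rmax <= r) by apply Rmax_r.
  destruct (flow_stability J L alpha k r HJ HL Halpha Hk HrJ) as [C [HC Hst]].
  (* Five sup norms occur: [n], [n'], [E], [E'] and [E''], the last being [n'] again. The extra [1]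
     pays for [b1 - b2] in the difference of [E' = n - b]. *)
  exists (5 * C + 1). split; [lra|].
  intros b1 b2 n1l n2l n1r n2r x1 x2 n1 E1 n2 E2 Hb1 Hb2 Hl1 Hl2 Hr1 Hr2
    Hb1m Hb2m Hl1m Hl2m Hr1m Hr2m S1 S2.
  assert (N1r := transonic_right _ _ _ _ _ _ _ _ _ S1).
  assert (N2r := transonic_right _ _ _ _ _ _ _ _ _ S2).
  destruct (flow_of_transonic J L alpha k r HJ HL b1 n1l n1r x1 n1 E1) as [m1 [e1 [p1 [F1 Q1]]]];
    [lra|lra|lra|lra|assumption|].
  destruct (flow_of_transonic J L alpha k r HJ HL b2 n2l n2r x2 n2 E2) as [m2 [e2 [p2 [F2 Q2]]]];
    [lra|lra|lra|lra|assumption|].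
  set (del := Rabs (b1 - b2) + Rabs (n1r - n2r)).
  assert (Hclose : forall x, 0 <= x <= L -> close C del m1 e1 p1 m2 e2 p2 (x - x1) (x - x2)).
  { intros x Hx. unfold del. rewrite <- N1r, <- N2r.
    destruct (Q1 L) as [-> _]; [lra|]. destruct (Q2 L) as [-> _]; [lra|].
    exact (Hst _ _ _ _ _ _ _ _ _ _ _ _ F1 F2 x Hx). }
  assert (Hdn : forall x,
     is_derive (fun x => m1 (x - x1) - m2 (x - x2)) x (p1 (x - x1) - p2 (x - x2))).
  { intros x. apply (is_derive_minus (fun x => m1 (x - x1)) (fun x => m2 (x - x2))).
    - apply (is_derive_shift m1), (flow_n _ _ _ _ _ _ _ _ _ _ _ F1).
    - apply (is_derive_shift m2), (flow_n _ _ _ _ _ _ _ _ _ _ _ F2). }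
  assert (HdE : forall x,
     is_derive (fun x => e1 (x - x1) - e2 (x - x2)) x ((m1 (x - x1) - b1) - (m2 (x - x2) - b2))).
  { intros x. apply (is_derive_minus (fun x => e1 (x - x1)) (fun x => e2 (x - x2))).
    - apply (is_derive_shift e1), (flow_E _ _ _ _ _ _ _ _ _ _ _ F1).
    - apply (is_derive_shift e2), (flow_E _ _ _ _ _ _ _ _ _ _ _ F2). }
  assert (HddE : forall x,
     is_derive (fun x => (m1 (x - x1) - b1) - (m2 (x - x2) - b2)) x (p1 (x - x1) - p2 (x - x2))).
  { intros x.
    apply (is_derive_ext (fun x => (m1 (x - x1) - m2 (x - x2)) + (b2 - b1))); [intros t; simpl; ring|].
    replace (p1 (x - x1) - p2 (x - x2)) with (p1 (x - x1) - p2 (x - x2) + 0) by ring.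
    apply (is_derive_plus (fun x => m1 (x - x1) - m2 (x - x2)) (fun _ => b2 - b1));
      [apply Hdn|apply @is_derive_const]. }
  assert (Hn : forall x, 0 <= x <= L -> n1 x - n2 x = m1 (x - x1) - m2 (x - x2)).
  { intros x Hx. destruct (Q1 x Hx) as [-> _]. now destruct (Q2 x Hx) as [-> _]. }
  assert (HE : forall x, 0 <= x <= L -> E1 x - E2 x = e1 (x - x1) - e2 (x - x2)).
  { intros x Hx. destruct (Q1 x Hx) as [_ ->]. now destruct (Q2 x Hx) as [_ ->]. }
  assert (HDE : forall x, 0 <= x <= L -> Derive_on 0 L (fun x => E1 x - E2 x) x
                  = (m1 (x - x1) - b1) - (m2 (x - x2) - b2)).
  { intros x Hx. eapply Derive_on_eq; [assumption|apply HdE|exact HE|assumption]. }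
  apply Rbar_le_trans with
    (Rbar_plus (Rbar_plus (Finite (C * del)) (Finite (C * del)))
       (Rbar_plus (Finite (C * del))
          (Rbar_plus (Finite (C * del + Rabs (b1 - b2))) (Finite (C * del))))).
  - simpl Ck_norm.
    apply Rbar_plus_le_compat; apply Rbar_plus_le_compat; [| | |apply Rbar_plus_le_compat];
      apply sup_norm_le; intros x Hx; destruct (Hclose x Hx) as [H1 [H2 H3]].
    + now rewrite Hn.
    + erewrite Derive_on_eq; [exact H3|assumption|apply Hdn|exact Hn|assumption].
    + now rewrite HE.
    + rewrite HDE by assumption.
      replace (m1 (x - x1) - b1 - (m2 (x - x2) - b2))
        with ((m1 (x - x1) - m2 (x - x2)) - (b1 - b2)) by ring.
      apply Rabs_sub_le; [assumption|apply Rle_refl].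
    + erewrite Derive_on_eq; [exact H3|assumption|apply HddE|exact HDE|assumption].
  - simpl. assert (G1 := Rabs_pos (n1l - n2l)). assert (G2 := Rabs_pos (n1r - n2r)).
    assert (0 <= C * Rabs (n1l - n2l)) by (apply Rmult_le_pos; lra).
    unfold del. lra.
Qed.
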